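(* Let $\mathcal{f},\mathcal{g}:\mathcal{O}\rightarrow\mathcal{P}$ be smooth and proper orbifold maps between orbifolds of the same dimension. Let $\mathcal{F}:\mathcal{O}\times[0,1]\rightarrow\mathcal{P}$ be a proper homotopy between $\mathcal{f}$ and $\mathcal{g}$. Let $y\in P$ be a smooth point. Suppose that $y$ is a regular value of $\mathcal{F}$, $\mathcal{f}$ and $\mathcal{g}$ simultaneously, and that $\Sigma^{\mathcal{O}}_{\dim\mathcal{O}-1}=\emptyset$. Then $\deg_2(\mathcal{f};y)=\deg_2(\mathcal{g};y)$.
   Context: Orbifolds: an $n$-dimensional (effective) orbifold $\mathcal{O}$ (without boundary) is a Hausdorff, second countable topological space $O$ with a maximal atlas of orbifold charts around each point. An orbifold chart around $x\in O$ consists of a connected open set $\tilde U_x\subset\mathbb{R}^n$, a smooth effective action on $\tilde U_x$ of a finite group $\Gamma_x$ (the isotropy group of $x$) fixing $0\in\tilde U_x$, and a homeomorphism $\phi_x$ from $\tilde U_x/\Gamma_x$ onto an open neighborhood $U_x$ of $x$ with $\phi_x(0)=x$. Charts are compatible: for charts $\tilde U_x,\tilde U_y$ and a point $z\in U_x\cap U_y$ there are a chart $\tilde U_z$ around $z$, injective group homomorphisms $\rho_{zx}:\Gamma_z\to\Gamma_x$, $\rho_{zy}:\Gamma_z\to\Gamma_y$ and smooth open embeddings $i_{zx}:\tilde U_z\to\tilde U_x$, $i_{zy}:\tilde U_z\to\tilde U_y$, equivariant with respect to $\rho_{zx},\rho_{zy}$ and covering the inclusions of $U_z$. Orbifolds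 with boundary are defined in the same way, with $\tilde U_x$ open in $[0,\infty)\times\mathbb{R}^{n-1}$. Strata: for $x\in O$ with lift $\tilde x=0\in\tilde U_x$, the singular dimension is $\mathrm{sdim}(x)=\dim (T_{\tilde x}\tilde U_x)^{\Gamma_x}$ (fixed subspace of the differential action), and $\Sigma^{\mathcal{O}}_i=\{x\in O: \mathrm{sdim}(x)=i\}$. Points of $\Sigma^{\mathcal{O}}_{\dim\mathcal{O}}$, i.e. points with trivial isotropy group, are called smooth points. Maps: a smooth (complete) orbifold map $\mathcal{f}=(f,\{\tilde f_x\},\{\Theta_x\}):\mathcal{O}\to\mathcal{P}$ consists of a continuous map $f:O\to P$ and, for each $x\in O$, a group homomorphism $\Theta_x:\Gamma_x\to\Gamma_{f(x)}$ and, in suitable charts around $x$ and $f(x)$, a smooth lift $\tilde f_x:\tilde U_x\to\tilde U_{f(x)}$ of $f$ (i.e. $\phi_{f(x)}([\tilde f_x(w)])=f(\phi_x([w]))$) with $\tilde f_x(\gamma w)=\Theta_x(\gamma)\tilde f_x(w)$ for $\gamma\in\Gamma_x$. Maps are identified if for every $x$ their lifts agree on some chart around $x$ and their homomorphisms agree. $\mathcal{f}$ is proper if $f$ is proper. Homotopy: $\mathcal{O}\times[0,1]$ carries the product orbifold structure (with boundary), with $\Gamma_{(x,t)}\cong\Gamma_x$ acting on the first factor of the charts. $\mathcal{i}_t:\mathcal{O}\to\mathcal{O}\times[0,1]$ denotes the time-$t$ inclusion. A homotopy between $\mathcal{f}$ and $\mathcal{g}$ is a smooth orbifold map $\mathcal{F}:\mathcal{O}\times[0,1]\to\mathcal{P}$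 with $\mathcal{F}\mathcal{i}_0=\mathcal{f}$ and $\mathcal{F}\mathcal{i}_1=\mathcal{g}$; it is proper if the underlying map $F$ is proper. Regularity: a point $x$ is a regular point of a smooth orbifold map $\mathcal{f}$ if $T_{\tilde x}\tilde f_x$ is surjective; $y\in P$ is a regular value if every $x\in f^{-1}(y)$ is a regular point. Degree: for $\mathcal{f}$ proper between orbifolds of the same dimension and $y$ a regular value (then $f^{-1}(y)$ is finite), the weighted cardinality is $\#_w\mathcal{f}^{-1}(y)=\sum_{x\in f^{-1}(y)}\frac{|\Gamma_y|}{|\Gamma_x|}$, which is an integer, and $\deg_2(\mathcal{f};y)=\#_w\mathcal{f}^{-1}(y)\bmod 2$. *)

(* Defs.v *)
From HB Require Import structures.
From mathcomp Require Import all_boot all_order all_algebra all_fingroup.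
From mathcomp Require Import all_classical all_reals all_analysis.

Set Implicit Arguments.
Unset Strict Implicit.
Unset Printing Implicit Defensive.

Import Order.TTheory GRing.Theory Num.Theory.
Import numFieldNormedType.Exports.

Local Open Scope classical_set_scope.
Local Open Scope ring_scope.

Section Smoothness.
Context {R : realType} {m n : nat}.
Implicit Types (A U : set 'rV[R]_m) (f g : 'rV[R]_m -> 'rV[R]_n).

Fixpoint Ck (k : nat) U f : Prop :=
  if k is k'.+1 then
    (forall x, U x -> differentiable f x) /\
    (forall v, Ck k' U (fun x => 'D_v f x))
  else forall x, U x -> {for x, continuous f}.

Definition Cinfty U f := forall k, Ck k U f.

(* g is a smooth function near x that extends the restriction of f to A *)
Definition local_extension A f x g :=
  exists U, [/\ open U, U x, Cinfty U g & {in U `&` A, f =1 g}].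

(* Functions are total; their values outside A are irrelevant here. *)
Definition smooth_on A f :=
  forall x, A x -> exists g, local_extension A f x g.

(* For A relatively open in R^m or in a half-space, 'd g x does not depend on
   the extension g: it is the tangent map of f at x, even at boundary points. *)
Definition regular_at A f x :=
  exists2 g, local_extension A f x g &
    set_surj [set: 'rV[R]_m] [set: 'rV[R]_n] ('d g x).

End Smoothness.

Definition relopen {T : topologicalType} (A S : set T) :=
  exists2 V, open V & S = A `&` V.

(* [0, +oo[ x R^(n-1) *)
Definition halfspace (R : realType) (n : nat) : set 'rV[R]_n :=
  [set v | forall i : 'I_n, i = 0%N :> nat -> 0 <= v ord0 i].

(* Collections of charts are plain predicates, since charts live in a universe
   too large for [set].

   The action and the projection to T are total functions; only their values
   on the domain are meaningful. *)
Record chart (R : realType) (T : Type) (n : nat) := Chart {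
  dom : set 'rV[R]_n;
  grp : finGroupType;
  act : grp -> 'rV[R]_n -> 'rV[R]_n;
  phi : 'rV[R]_n -> T }.

Definition restrict (R : realType) (T : Type) (n : nat) (c : chart R T n)
    (W : set 'rV[R]_n) : chart R T n :=
  Chart W (@act _ _ _ c) (phi c).

Section Charts.
Context {R : realType} {T : topologicalType} {n : nat}.
Implicit Types (a b c : chart R T n) (A B : chart R T n -> Prop).

Definition cimage c : set T := phi c @` dom c.

(* The flag bd allows charts at boundary points. Every chart is centred at 0:
   around an interior point of an orbifold with boundary, an open subset of
   ]0, +oo[ x R^(n-1) is translated so that the fixed point becomes 0. *)
Record is_chart (bd : bool) c : Prop := IsChart {
  dom_open : open (dom c) \/ bd /\ relopen (@halfspace R n) (dom c);
  dom_connected : connected (dom c);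
  dom0 : dom c 0;
  act_dom : forall (g : grp c) w, dom c w -> dom c (act g w);
  act1 : forall w, dom c w -> act (1%g : grp c) w = w;
  actM : forall (g h : grp c) w, dom c w ->
    act (g * h)%g w = act g (act h w);
  act_smooth : forall g : grp c, smooth_on (dom c) (act g);
  act_effective : forall g : grp c,
    (forall w, dom c w -> act g w = w) -> g = 1%g;
  act_fix0 : forall g : grp c, act g 0 = 0;
  (* phi induces a homeomorphism from the orbit space, with its quotient
     topology, onto the open set cimage c *)
  phi_fibre : forall v w, dom c v -> dom c w ->
    (phi c v = phi c w <-> exists g : grp c, w = act g v);
  phi_open : open (cimage c);
  phi_quotient : forall V, V `<=` cimage c ->
    (open V <-> relopen (dom c) (dom c `&` phi c @^-1` V)) }.

Definition embeds c a :=
  exists (rho : grp c -> grp a) (i : 'rV[R]_n -> 'rV[R]_n),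
  [/\ injective rho /\ {morph rho : g h / (g * h)%g},
      smooth_on (dom c) i /\ relopen (dom a) (i @` dom c),
      exists2 j, smooth_on (i @` dom c) j & {in dom c, cancel i j},
      forall g w, dom c w -> i (act g w) = act (rho g) (i w) &
      forall w, dom c w -> phi a (i w) = phi c w].

Record is_atlas (bd : bool) A : Prop := IsAtlas {
  atlas_chart : forall c, A c -> is_chart bd c;
  atlas_cover : forall x : T, exists2 c, A c & phi c 0 = x;
  atlas_compat : forall a b z, A a -> A b -> cimage a z -> cimage b z ->
    exists2 c, A c & [/\ phi c 0 = z, embeds c a & embeds c b] }.

Definition maximal_atlas (bd : bool) A :=
  is_atlas bd A /\ forall B, is_atlas bd B ->
    (forall c, A c -> B c) -> forall c, B c -> A c.

Definition generated_atlas (bd : bool) A c :=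
  exists2 B, is_atlas bd B /\ (forall a, A a -> B a) & B c.

End Charts.

(* Isotropy groups, lifts and the equality of maps refer to a chart around each
   point that is part of the data, chosen in the maximal atlas. *)
Record orb_data (R : realType) (n : nat) := OrbData {
  space :> topologicalType;
  atlas : chart R space n -> Prop;
  chart_at : space -> chart R space n }.

Record is_orbifold (R : realType) (n : nat) (bd : bool) (O : orb_data R n)
    : Prop := IsOrbifold {
  orb_hausdorff : hausdorff_space O;
  orb_second_countable : @second_countable O;
  orb_atlas : maximal_atlas bd (@atlas R n O);
  orb_chart_at : forall x : O, atlas (chart_at x) /\ phi (chart_at x) 0 = x }.

Record orbifold (R : realType) (n : nat) := Orbifold {
  orb_struct :> orb_data R n;
  orbifoldP : is_orbifold false orb_struct }.

Section Strata.
Context {R : realType} {n : nat} (O : orb_data R n).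

Definition isotropy (x : O) : finGroupType := grp (chart_at x).

(* Row vectors: the rows of this matrix span the subspace fixed by the
   differentials at 0 of all elements of the isotropy group. *)
Definition fixed_space (x : O) : 'M[R]_n :=
  (\bigcap_(g : isotropy x) eigenspace (jacobian (act g) 0) 1)%MS.

Definition sdim (x : O) : nat := \rank (fixed_space x).

Definition stratum (i : int) : set O := [set x | (sdim x)%:Z = i].

Definition smooth_point : set O := stratum n%:Z.

(* W is the domain of a chart around x contained in the chosen one *)
Definition chart_nbhd (x : O) (W : set 'rV[R]_n) :=
  W `<=` dom (chart_at x) /\ atlas (restrict (chart_at x) W).

End Strata.

Arguments stratum {R n} O i.
Arguments smooth_point {R n} O.

Record orb_map (R : realType) (m n : nat) (O : orb_data R m)
    (P : orb_data R n) := OrbMap {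
  omap :> O -> P;
  lift : O -> 'rV[R]_m -> 'rV[R]_n;
  hom : forall x : O, isotropy x -> isotropy (omap x) }.

Section Maps.
Context {R : realType} {m n : nat} {O : orb_data R m} {P : orb_data R n}.
Implicit Types f g : orb_map O P.

Definition is_lift f (x : O) (W : set 'rV[R]_m) :=
  [/\ smooth_on W (lift f x),
      forall w, W w -> dom (chart_at (f x)) (lift f x w),
      forall w, W w ->
        phi (chart_at (f x)) (lift f x w) = f (phi (chart_at x) w) &
      forall (g : isotropy x) w, W w ->
        lift f x (act g w) = act (hom f g) (lift f x w)].

Definition smooth_map f :=
  [/\ continuous f,
      forall x, {morph @hom _ _ _ _ _ f x : g h / (g * h)%g} &
      forall x, exists2 W, chart_nbhd x W & is_lift f x W].

Definition map_eq f g :=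
  forall x : O, exists e : f x = g x,
    (exists2 W, chart_nbhd x W & {in W, lift f x =1 lift g x}) /\
    (forall h : isotropy x, ecast y (isotropy y) e (hom f h) = hom g h).

Definition proper_map f :=
  forall K : set P, compact K -> compact (f @^-1` K).

Definition regular_point f (x : O) :=
  regular_at (dom (chart_at x)) (lift f x) 0.

Definition regular_value f (y : P) :=
  forall x, f x = y -> regular_point f x.

Definition weighted_card f (y : P) : rat :=
  \sum_(x \in (f : O -> P) @^-1` [set y])
     (#|isotropy y|%:R / #|isotropy x|%:R : rat).

(* Num.truncn is exact here: the weighted cardinality over a regular value of a
   proper map is a natural number. *)
Definition deg2 f (y : P) : nat := (Num.truncn (weighted_card f y) %% 2)%N.

End Maps.

Definition orb_comp (R : realType) (l m n : nat) (O : orb_data R l)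
    (P : orb_data R m) (Q : orb_data R n) (g : orb_map P Q) (f : orb_map O P)
    : orb_map O Q :=
  @OrbMap R l n O Q (fun x => g (f x)) (fun x => lift g (f x) \o lift f x)
    (fun x h => hom g (hom f h)).

Definition unit_interval (R : realType) := set_type `[0 : R, 1]%classic.

Lemma itv01_0 (R : realType) : (0 : R) \in `[0 : R, 1]%classic.
Proof. by rewrite inE /= in_itv /= lexx ler01. Qed.

Lemma itv01_1 (R : realType) : (1 : R) \in `[0 : R, 1]%classic.
Proof. by rewrite inE /= in_itv /= lexx ler01. Qed.

Definition time0 (R : realType) : unit_interval R := SigSub (itv01_0 R).
Definition time1 (R : realType) : unit_interval R := SigSub (itv01_1 R).

Section Cylinder.
Context {R : realType}.

(* Charts of [0, 1] around t: the coordinate s in slice t stands for the time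
   1 - s if t = 1, and t + s otherwise. *)
Definition slice (t : unit_interval R) : set R :=
  let r := set_val t in
  if (r == 0) || (r == 1) then `[0, 1[%classic else `]- r, 1 - r[%classic.

Definition time (t : unit_interval R) (s : R) : unit_interval R :=
  let r := set_val t in
  insubd (time0 R) (if r == 1 then 1 - s else r + s).

Definition prod_chart (T : Type) (n : nat) (c : chart R T n)
    (t : unit_interval R) : chart R (T * unit_interval R) (1 + n) :=
  @Chart R (T * unit_interval R)%type (1 + n)
    [set v | slice t (lsubmx v ord0 ord0) /\ dom c (rsubmx v)]
    (grp c)
    (fun g v => row_mx (lsubmx v) (act g (rsubmx v)))
    (fun v => (phi c (rsubmx v), time t (lsubmx v ord0 ord0))).

Definition cylinder (n : nat) (O : orb_data R n) : orb_data R (1 + n) :=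
  @OrbData R (1 + n) (O * unit_interval R)%type
    (generated_atlas true
       (fun d => exists2 c, @atlas R n O c & exists t, d = prod_chart c t))
    (fun xt => prod_chart (chart_at xt.1) xt.2).

(* The time-t inclusion; t has coordinate 0 in the chart centred at t. *)
Definition time_incl (n : nat) (O : orb_data R n) (t : unit_interval R)
    : orb_map O (cylinder O) :=
  @OrbMap R n (1 + n) O (cylinder O) (fun x => (x, t))
    (fun _ w => row_mx (0 : 'rV[R]_1) w) (fun _ h => h).

Definition homotopy (m n : nat) (O : orb_data R m) (P : orb_data R n)
    (F : orb_map (cylinder O) P) (f g : orb_map O P) :=
  [/\ smooth_map F,
      map_eq (orb_comp F (time_incl O (time0 R))) f &
      map_eq (orb_comp F (time_incl O (time1 R))) g].

End Cylinder.

(* Main.v *)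
(* Over y the local group is trivial, so F is invariant under the isotropy of
   every point (x, t) of the fibre M of F over y.  Averaging over the isotropy
   group of x shows that its fixed space has dimension at least that of the image
   of the slice differential, which is at least n - 1 since F is a submersion
   there; as there is no stratum of codimension 1, x is a smooth point.  Hence M
   is a compact curve, by the implicit function theorem, whose boundary consists
   of the fibres of f and g over y, and the number of boundary points of a compact
   curve is even.  The parity is obtained without classifying curves: the parity
   of the number of jumps of a piecewise constant function M -> bool is additive,
   it is 0 for functions supported in an arc, and the function 1 extended by 0
   beyond the boundary jumps exactly at the boundary points. *)

Require Import Defs.
From HB Require Import structures.
From mathcomp Require Import all_boot all_order all_algebra all_fingroup.
From mathcomp Require Import all_classical all_reals all_analysis.
From mathcomp Require Import ring lra.

Set Implicit Arguments.
Unset Strict Implicit.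
Unset Printing Implicit Defensive.

Import Order.TTheory GRing.Theory Num.Theory.
Import numFieldNormedType.Exports.

Local Open Scope classical_set_scope.
Local Open Scope ring_scope.

(** The obstacle is the boundary: charts at the ends of the cylinder are relatively open in a
    half-space, whereas the implicit function theorem wants a full ball. The lift of F is therefore
    replaced by a smooth extension G; the zeros of G are parametrised in a ball, and the sign of the
    parameter cuts the arc afterwards. For this the parameter at an end must be the time coordinate,
    which is what regularity of y for f and g allows; elsewhere any coordinate completing the
    differential to an invertible matrix will do. Only a topological curve is needed, so arcs are
    merely continuous and derivatives are used in strict form at a single point. An arc is described
    by equality of two filters: neighbourhoods of a parameter within the arc domain, and
    neighbourhoods of its image within M. This equivalence contains both continuity and openness,
    and it carries every local statement between M and the line. Triviality of the isotropy groups
    along M serves twice: it makes [phi] injective, so that curves in charts are arcs in the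
    underlying space, and it makes every weight in the degree equal to 1. *)

Lemma connected_locally_constant (T : topologicalType) (A : set T)
    (h : T -> bool) :
  connected A -> (forall x, A x -> \forall y \near x, h y = h x) ->
  forall x y, A x -> A y -> h x = h y.
Proof.
move=> cA hloc x y Ax Ay.
have E : A `&` [set z | h z = h x] = A.
  apply: cA; first by exists x.
  - exists ([set z | h z = h x]°); first exact: open_interior.
    apply/seteqP; split => z [Az hz]; split => //=; last exact: nbhs_singleton hz.
    by move: (hloc z Az); rewrite /interior /= hz.
  - exists (~` [set z | h z != h x]°); first by apply: open_closedC; exact: open_interior.
    apply/seteqP; split => z [Az hz]; split => //=.
      by move=> /nbhs_singleton /=; rewrite hz eqxx.
    apply: contrapT => hzx; apply: hz; rewrite /interior /=.
    by apply: filterS (hloc z Az) => t /= ->; apply/eqP.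
by move: Ay; rewrite -E => -[_ /= ->].
Qed.

Lemma odd_count_addb (T : Type) (a b : pred T) (s : seq T) :
  odd (count (fun x => a x (+) b x) s) = odd (count a s) (+) odd (count b s).
Proof.
elim: s => //= x s IH; rewrite !oddD IH.
by case: (a x); case: (b x); case: (odd (count a s)); case: (odd (count b s)).
Qed.

(** * Jumps of Boolean functions on the real line *)

Section OneSided.
Context {R : realType}.
Implicit Types (h : R -> bool) (x : R).

(** Like [llim], also [false] when no one-sided limit exists, so its value is meaningful only under
    [one_sided]. *)
Definition rlim h x := `[< \forall y \near x^'+, h y >].
Definition llim h x := `[< \forall y \near x^'-, h y >].
Definition one_sided h x :=
  (\forall y \near x^'+, h y = rlim h x) /\
  (\forall y \near x^'-, h y = llim h x).
(** Blind to the value at x itself, so it does not matter whether an arc contains its end points. *)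
Definition jump h x := llim h x (+) rlim h x.

Lemma rlimP h x b : (\forall y \near x^'+, h y = b) -> rlim h x = b.
Proof.
rewrite /rlim => H; case: b H => H; first exact/asboolP.
apply/asboolPn => H'.
have : \forall y \near x^'+, False by apply: filterS2 H H' => y ->.
by case/filter_ex.
Qed.

Lemma llimP h x b : (\forall y \near x^'-, h y = b) -> llim h x = b.
Proof.
rewrite /llim => H; case: b H => H; first exact/asboolP.
apply/asboolPn => H'.
have : \forall y \near x^'-, False by apply: filterS2 H H' => y ->.
by case/filter_ex.
Qed.

Lemma rlim_near h x b : (\forall y \near x, h y = b) -> rlim h x = b.
Proof. by move=> H; apply: rlimP; exact: cvg_within H. Qed.

Lemma jump_near h x b : (\forall y \near x, h y = b) -> jump h x = false.
Proof.
move=> H; rewrite /jump (rlim_near H) (@llimP h x b) ?addbb //.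
exact: cvg_within H.
Qed.

Lemma near_rightP x (P : set R) :
  (\forall y \near x^'+, P y) <->
  exists2 e, 0 < e & forall y, x < y < x + e -> P y.
Proof.
split=> [/nbhs_ballP[e /= e0 H]|[e e0 H]].
  exists e => // y /andP[xy ye]; apply: H => //=.
  by rewrite /ball /= distrC ger0_norm; lra.
apply/nbhs_ballP; exists e => // y; rewrite /ball /= => yx xy; apply: H.
by rewrite xy /=; move: yx; rewrite distrC ger0_norm; lra.
Qed.

Lemma near_leftP x (P : set R) :
  (\forall y \near x^'-, P y) <->
  exists2 e, 0 < e & forall y, x - e < y < x -> P y.
Proof.
split=> [/nbhs_ballP[e /= e0 H]|[e e0 H]].
  exists e => // y /andP[xy ye]; apply: H => //=.
  by rewrite /ball /= ger0_norm; lra.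
apply/nbhs_ballP; exists e => // y; rewrite /ball /= => yx xy; apply: H.
by rewrite xy andbT; move: yx; rewrite ger0_norm; lra.
Qed.

Lemma near_open_itv a b x : a < x < b -> \forall y \near x, a < y < b.
Proof.
move=> H; have : open [set` `]a, b[%R] by exact: interval_open.
by rewrite openE => /(_ x); rewrite /= in_itv /= => /(_ H); apply: filterS => y; rewrite /= in_itv.
Qed.

Lemma itv_locally_constant h a b :
  (forall x, a < x < b -> \forall y \near x, h y = h x) ->
  exists c, forall x, a < x < b -> h x = c.
Proof.
move=> H; exists (h ((a + b) / 2)) => x xab.
have cn : connected [set` `]a, b[%R] by apply/connected_intervalP; exact: interval_is_interval.
apply: (connected_locally_constant cn) => [y|/=|/=]; rewrite /= in_itv /=; last lra.
  exact: H.
done.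
Qed.

(** Local constancy on the two intervals adjacent to x makes h constant on each of them, by
    connectedness. *)
Lemma locally_constant_one_sided h x :
  (\forall y \near x^', \forall z \near y, h z = h y) -> one_sided h x.
Proof.
move=> /nbhs_ballP[e /= e0 H].
have [br Hbr] : exists c, forall y, x < y < x + e -> h y = c.
  apply: itv_locally_constant => y yx; apply: H => /=.
    by rewrite /ball /= distrC ger0_norm; lra.
  by apply/eqP; lra.
have [bl Hbl] : exists c, forall y, x - e < y < x -> h y = c.
  apply: itv_locally_constant => y yx; apply: H => /=.
    by rewrite /ball /= ger0_norm; lra.
  by apply/eqP; lra.
have Nr : \forall y \near x^'+, h y = br by apply/near_rightP; exists e.
have Nl : \forall y \near x^'-, h y = bl by apply/near_leftP; exists e.
by split; rewrite ?(rlimP Nr) ?(llimP Nl).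
Qed.

Lemma near_norm_gt a x : a < `|x| -> \forall y \near x, a < `|y|.
Proof.
have cn : continuous (fun y : R => `|y|) by exact: norm_continuous.
by move=> h; have := cn x _ (lt_nbhsr h); apply.
Qed.

Lemma near_norm_lt a x : `|x| < a -> \forall y \near x, `|y| < a.
Proof.
have cn : continuous (fun y : R => `|y|) by exact: norm_continuous.
by move=> h; have := cn x _ (lt_nbhsl h); apply.
Qed.

Lemma near_lr x (P : set R) : P x -> (\forall y \near x^'+, P y) ->
  (\forall y \near x^'-, P y) -> \forall y \near x, P y.
Proof.
move=> Px /near_rightP[e e0 He] /near_leftP[d d0 Hd].
have : x - d < x < x + e by lra.
move=> /near_open_itv; apply: filterS => y ye.
by case: (ltgtP x y) => [xy|yx|<-//]; [apply: He; lra | apply: Hd; lra].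
Qed.

(* The value just to the right of x, corrected by the parity of the number of
   jumps up to x, is locally constant in x. *)
Lemma even_jumps h c L :
  (forall x, one_sided h x) -> (forall x, c < `|x| -> h x = false) ->
  uniq L -> (forall x, jump h x -> x \in L) -> ~~ odd (count (jump h) L).
Proof.
move=> hos hc uL hL.
pose k x := rlim h x (+) odd (count (fun s => jump h s && (s <= x)) L).
have kloc x : \forall y \near x, k y = k x.
  have [/near_rightP[e e0 He] /near_leftP[d d0 Hd]] := hos x.
  have Jr s : x < s < x + e -> jump h s = false.
    move=> sx; apply: (@jump_near h s (rlim h x)).
    by apply: filterS (near_open_itv sx).
  have Jl s : x - d < s < x -> jump h s = false.
    move=> sx; apply: (@jump_near h s (llim h x)).
    by apply: filterS (near_open_itv sx).
  apply: near_lr => //.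
    apply/near_rightP; exists e => // y yx; rewrite /k.
    have -> : rlim h y = rlim h x.
      by apply: rlim_near; apply: filterS (near_open_itv yx).
    congr (_ (+) odd _); apply: eq_count => s /=.
    case: (leP s x) => sx; first by have -> : s <= y by lra.
    case: (leP s y) => sy //; rewrite Jr //; lra.
  (* Moving left from x replaces the right limit by the left one and drops x from the count; both
     changes amount to [jump h x], so they cancel. *)
  apply/near_leftP; exists d => // y yx; rewrite /k.
  have -> : rlim h y = llim h x.
    by apply: rlim_near; apply: filterS (near_open_itv yx).
  have -> : count (fun s => jump h s && (s <= x)) L =
      count (fun s => (jump h s && (s <= y)) (+) (jump h x && (s == x))) L.
    apply: eq_count => s /=; case: (ltgtP s x) => [sx|sx|->] /=.
    - rewrite andbT andbF addbF; case: (leP s y) => sy; first by rewrite andbT.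
      by rewrite Jl //; lra.
    - by have -> : (s <= y) = false by [apply/negbTE; rewrite -ltNge; lra]; rewrite !andbF.
    - by have -> : (x <= y) = false by [apply/negbTE; rewrite -ltNge; lra]; rewrite !andbT andbF.
  rewrite odd_count_addb.
  have -> : odd (count (fun s => jump h x && (s == x)) L) = jump h x.
    case E : (jump h x) => /=; last by rewrite count_pred0.
    by rewrite (count_uniq_mem x uL) hL.
  rewrite /jump; case: (llim h x); case: (rlim h x) => //=;
  by case: (odd _).
(* The bound c may be negative; with the maximum, [C + 1] and its opposite lie on either side of all
   jumps, where k counts every jump and none. *)
have c0 : 0 <= Num.max c 0 by rewrite le_max lexx orbT.
have cc : c <= Num.max c 0 by rewrite le_max lexx.
set C := Num.max c 0 in c0 cc.
have jc s : jump h s -> `|s| <= C.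
  apply: contraTT; rewrite -ltNge => Cs; apply/negbT/(@jump_near h s false).
  by apply: filterS (near_norm_gt Cs) => y Cy; apply: hc; lra.
have kE : k (- (C + 1)) = k (C + 1).
  by apply: (@connected_locally_constant _ setT) => //; apply/connected_intervalP.
have hrl x : C < `|x| -> rlim h x = false.
  move=> Cs; apply/rlim_near.
  by apply: filterS (near_norm_gt Cs) => y Cy; apply: hc; lra.
move: kE; rewrite /k !hrl ?normrN ?ger0_norm; try lra; rewrite /=.
rewrite (@eq_count _ _ pred0) ?count_pred0 => [/esym|s /=]; last first.
  case J : (jump h s) => //=; move/jc: J; rewrite ler_norml => /andP[s1 s2].
  by apply/negbTE; rewrite -ltNge; lra.
rewrite (@eq_count _ _ (jump h)) => [->//|s /=].
case J : (jump h s) => //=; move/jc: J; rewrite ler_norml => /andP[s1 s2].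
by lra.
Qed.

End OneSided.

(** Otherwise the sets of points of K missed by finitely many [V y] generate a proper filter. It has
    a cluster point x in K, but the member missed by [V x] does not meet the neighbourhood [V x] of
    x. *)
Lemma compact_finite_cover (T : topologicalType) (K : set T) (V : T -> set T) :
  compact K -> (forall x, K x -> nbhs x (V x)) ->
  exists2 L : seq T, (forall x, x \in L -> K x) &
    forall x, K x -> exists2 y, y \in L & V y x.
Proof.
move=> cK hV; apply: contrapT => nL.
pose U (L : seq T) := [set x | K x /\ forall y, y \in L -> ~ V y x].
pose F := filter_from [set L : seq T | forall x, x \in L -> K x] U.
have FF : ProperFilter F.
  apply: filter_from_proper.
    apply: filter_from_filter; first by exists [::].
    move=> L1 L2 K1 K2; exists (L1 ++ L2) => [x|x [Kx hx]].
      by rewrite mem_cat => /orP[/K1|/K2].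
    by split; split=> // y yL; apply: hx; rewrite mem_cat yL ?orbT.
  move=> L KL; apply: contrapT => /nonemptyPn U0; apply: nL; exists L => // x Kx.
  apply: contrapT => nx; have : U L x by split=> // y yL Vy; apply: nx; exists y.
  by rewrite U0.
have [x [Kx clx]] : K `&` cluster F !=set0.
  by apply: cK; exists [::] => // x [].
have Fx : F (U [:: x]) by exists [:: x] => // y; rewrite inE => /eqP ->.
by have [y [[_ /(_ x)]]] := clx _ _ Fx (hV x Kx); rewrite inE eqxx => /(_ isT).
Qed.

Lemma eq_count_sub (T : eqType) (a : pred T) (s1 s2 : seq T) :
  uniq s1 -> uniq s2 -> {subset s1 <= s2} ->
  (forall x, x \in s2 -> a x -> x \in s1) -> count a s1 = count a s2.
Proof.
move=> u1 u2 s12 h; rewrite -!size_filter; apply/perm_size/uniq_perm.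
- exact: filter_uniq.
- exact: filter_uniq.
- move=> x; rewrite !mem_filter; case ax : (a x) => //=.
  by apply/idP/idP => [/s12|/h ->].
Qed.

(** The right-hand condition does not distinguish the two sides of x, so it survives any change of
    parameter, even one that reverses orientation. *)
Lemma jumpFP (R : realType) (h : R -> bool) (x : R) : one_sided h x ->
  jump h x = false <-> exists c, \forall y \near x^', h y = c.
Proof.
move=> [hr hl]; split.
  move=> J; have E : llim h x = rlim h x.
    by move: J; rewrite /jump; case: (llim h x); case: (rlim h x).
  exists (rlim h x); move/near_rightP: hr => [e e0 He]; move/near_leftP: hl => [d d0 Hd].
  have : x - d < x < x + e by lra.
  move=> /near_open_itv; apply: filterS => y ye /= /eqP xy.
  case: (ltgtP x y) => [xy'|yx|] //; first by apply: He; lra.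
  - by rewrite Hd ?E //; lra.
  - by move=> /esym.
move=> [c H]; have {}H : nbhs x (fun y => y != x -> h y = c) := H.
rewrite /jump (@rlimP _ _ _ c) ?(@llimP _ _ _ c) ?addbb //.
  by apply: filterS H => y Hy xy; apply: Hy; apply/eqP; lra.
by apply: filterS H => y Hy xy; apply: Hy; apply/eqP; lra.
Qed.

(** * Parity of the number of jumps on a compact curve with boundary *)

Section CurveParity.
Context {R : realType} {X : topologicalType} (M B : set X)
  (r : X -> R) (gam : X -> R -> X).

Definition arc_dom (p : X) (s : R) : bool :=
  (if `[< B p >] then 0 <= s else - r p < s) && (s < r p).

(* M is a curve, with boundary B, near each of its points *)
Definition is_arc (p : X) := [/\ 0 < r p,
  gam p 0 = p,
  {in arc_dom p &, injective (gam p)},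
  (forall s, arc_dom p s -> M (gam p s)) /\
  (forall s, arc_dom p s -> B (gam p s) -> s = 0) &
  forall s, arc_dom p s -> forall A : set X,
    (\forall t \near s, arc_dom p t -> A (gam p t)) <->
    (\forall q \near gam p s, M q -> A q)].

Context (arcP : forall p, M p -> is_arc p).

(** Piecewise constant functions: the points where local constancy along M fails do not accumulate
    in M. *)
Definition tame (chi : X -> bool) := forall q, M q ->
  \forall q' \near q, M q' -> q' != q ->
  \forall q'' \near q', M q'' -> chi q'' = chi q'.

Definition pull (p : X) (chi : X -> bool) (s : R) := arc_dom p s && chi (gam p s).
(** Read in the chosen arc centred at p; [mjump_arc] shows that every other chosen arc through p
    gives the same value. *)
Definition mjump (chi : X -> bool) (p : X) := jump (pull p chi) 0.

Lemma arc_dom0 p : M p -> arc_dom p 0.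
Proof.
by move=> /arcP[rp _ _ _ _]; rewrite /arc_dom rp andbT; case: ifP => // _; lra.
Qed.

(** The domain has a single non-interior parameter, the end 0 of a boundary arc; hence the punctured
    neighbourhood. *)
Lemma arc_dom_near p s : arc_dom p s ->
  \forall t \near s, t != s ->
    (\forall u \near t, arc_dom p u) \/ (\forall u \near t, ~~ arc_dom p u).
Proof.
rewrite /arc_dom; case: ifP => _ /andP[s0 sr].
  have : - r p < s < r p by lra.
  move=> /near_open_itv; case: (ltgtP s 0) => [|s1|->] H; first lra.
    have : 0 < s < r p by lra.
    move=> /near_open_itv; apply: filterS => t ht _; left.
    by apply: filterS (near_open_itv ht) => u ?; apply/andP; split; lra.
  apply: filterS H => t ht /eqP t0; case: (ltgtP t 0) => // tn.
    right; have : t - 1 < t < 0 by lra.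
    move=> /near_open_itv; apply: filterS => u hu.
    by rewrite negb_and -ltNge; apply/orP; left; lra.
  left; have : 0 < t < r p by lra.
  by move=> /near_open_itv; apply: filterS => u hu; apply/andP; split; lra.
have : - r p < s < r p by lra.
move=> /near_open_itv; apply: filterS => t ht _; left.
by apply: filterS (near_open_itv ht).
Qed.

Lemma pull_locally_constant p chi s : M p -> tame chi -> arc_dom p s ->
  \forall t \near s^', \forall u \near t, pull p chi u = pull p chi t.
Proof.
move=> Mp tc ds; have [_ _ ginj [gM _] gn] := arcP Mp.
have := tc _ (gM _ ds).
rewrite -(gn _ ds (fun q' => q' != gam p s ->
  \forall q'' \near q', M q'' -> chi q'' = chi q')) => H.
rewrite /dnbhs /within /=; move: (arc_dom_near ds) H.
apply: filterS2 => t /[swap] H /[swap] ts /(_ ts)[] Ht; last first.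
  have nt := nbhs_singleton Ht.
  by apply: filterS Ht => u nu; rewrite /pull (negbTE nu) (negbTE nt).
have dt := nbhs_singleton Ht.
have nts : gam p t != gam p s by apply: contra_neq ts; exact: ginj.
have := H dt nts; rewrite -(gn _ dt (fun q => chi q = chi (gam p t))).
apply: filterS2 Ht => u du /(_ du) E.
by rewrite /pull du dt E.
Qed.

Lemma pull_one_sided p chi s : M p -> tame chi -> arc_dom p s ->
  one_sided (pull p chi) s.
Proof. by move=> *; apply/locally_constant_one_sided/pull_locally_constant. Qed.

Lemma interior_jumpP p chi s : M p -> tame chi -> (\forall t \near s, arc_dom p t) ->
  jump (pull p chi) s = false <->
  exists c, \forall q \near gam p s, M q -> q != gam p s -> chi q = c.
Proof.
move=> Mp tc dn; have ds := nbhs_singleton dn.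
have [_ _ ginj _ gn] := arcP Mp.
rewrite jumpFP; last exact: pull_one_sided.
split=> -[c H]; exists c.
  rewrite -(gn _ ds (fun q => q != gam p s -> chi q = c)).
  apply: filterS2 dn H => t dt H _ nts.
  have : t != s by apply: contra_neq nts => ->.
  by move=> /H; rewrite /pull dt.
move: H; rewrite -(gn _ ds (fun q => q != gam p s -> chi q = c)) => H.
rewrite /dnbhs /within /=; apply: filterS2 dn H => t dt /(_ dt) H ts.
by rewrite /pull dt H //; apply: contra_neq ts; exact: ginj.
Qed.

(** An arc meets B only at its centre, where there is nothing to compare. At interior points both
    jumps vanish exactly when chi is constant on a punctured neighbourhood in M, a condition that
    mentions no arc. *)
Lemma mjump_arc p chi s : M p -> tame chi -> arc_dom p s ->
  mjump chi (gam p s) = jump (pull p chi) s.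
Proof.
move=> Mp tc ds; have [rp g0 _ [gM gB] _] := arcP Mp.
have [Bq|nBq] := pselect (B (gam p s)).
  by rewrite (gB _ ds Bq) g0.
have [rq gq0 _ _ _] := arcP (gM _ ds).
have dq : \forall t \near (0 : R), arc_dom (gam p s) t.
  have : - r (gam p s) < 0 < r (gam p s) by lra.
  move=> /near_open_itv; apply: filterS => t ht.
  by rewrite /arc_dom; case: asboolP.
have dp : \forall t \near s, arc_dom p t.
  move: ds; rewrite /arc_dom; case: asboolP => [Bp|_] /andP[s1 s2].
    have s0 : s != 0 by apply/eqP => s0; apply: nBq; rewrite s0 g0.
    have : 0 < s < r p by rewrite lt_neqAle eq_sym s0 s1.
    by move=> /near_open_itv; apply: filterS => t ?; lra.
  have : - r p < s < r p by lra.
  by move=> /near_open_itv; apply: filterS => t ?.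
have := interior_jumpP (gM _ ds) tc dq; rewrite gq0 -(interior_jumpP Mp tc dp) /mjump.
by case: jump; case: jump => // -[h1 h2]; [move: (h2 erefl)|move: (h1 erefl)].
Qed.

Lemma isolated_mjump chi q : M q -> tame chi ->
  \forall q' \near q, M q' -> q' != q -> mjump chi q' = false.
Proof.
move=> Mq tc; have d0 := arc_dom0 Mq; have [_ g0 _ _ gn] := arcP Mq.
rewrite -{1}g0 -(gn _ d0 (fun q' => q' != q -> mjump chi q' = false)).
have H0 : nbhs 0 (fun t : R => t != 0 -> \forall u \near t, pull q chi u = pull q chi t) :=
  pull_locally_constant Mq tc d0.
apply: filterS H0 => t H dt ntq; rewrite mjump_arc //.
by apply: jump_near (H _); apply: contra_neq ntq => ->.
Qed.

Lemma finite_mjump chi : compact M -> tame chi ->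
  exists L : seq X, forall q, M q -> mjump chi q -> q \in L.
Proof.
move=> cM tc.
have [L _ HL] := compact_finite_cover cM (fun q Mq => isolated_mjump Mq tc).
exists L => q Mq jq; have [p pL] := HL q Mq.
by case: (eqVneq q p) => [-> //|qp] /(_ Mq isT); rewrite jq.
Qed.

Lemma tame_op (op : bool -> bool -> bool) chi1 chi2 : tame chi1 -> tame chi2 ->
  tame (fun q => op (chi1 q) (chi2 q)).
Proof.
move=> t1 t2 q Mq; apply: filterS2 (t1 q Mq) (t2 q Mq) => q' H1 H2 Mq' nq.
by apply: filterS2 (H1 Mq' nq) (H2 Mq' nq) => q'' E1 E2 Mq''; rewrite E1 ?E2.
Qed.

Lemma mjump_addb chi1 chi2 p : M p -> tame chi1 -> tame chi2 ->
  mjump (fun q => chi1 q (+) chi2 q) p = mjump chi1 p (+) mjump chi2 p.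
Proof.
move=> Mp t1 t2; have d0 := arc_dom0 Mp.
have [r1 l1] := pull_one_sided Mp t1 d0; have [r2 l2] := pull_one_sided Mp t2 d0.
have E s : pull p (fun q => chi1 q (+) chi2 q) s = pull p chi1 s (+) pull p chi2 s.
  by rewrite /pull; case: arc_dom.
rewrite /mjump /jump.
rewrite (@rlimP _ _ _ (rlim (pull p chi1) 0 (+) rlim (pull p chi2) 0)); last first.
  by apply: filterS2 r1 r2 => s; rewrite E => -> ->.
rewrite (@llimP _ _ _ (llim (pull p chi1) 0 (+) llim (pull p chi2) 0)); last first.
  by apply: filterS2 l1 l2 => s; rewrite E => -> ->.
by rewrite addbACA.
Qed.

(** The list may be any one that contains the jump points, so that several functions can be counted
    on a common list. *)
Definition even_mjump chi := forall L, uniq L -> (forall q, q \in L -> M q) ->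
  (forall q, M q -> mjump chi q -> q \in L) -> ~~ odd (count (mjump chi) L).

Lemma even_mjump_addb chi1 chi2 : compact M -> tame chi1 -> tame chi2 ->
  even_mjump chi1 -> even_mjump chi2 ->
  even_mjump (fun q => chi1 q (+) chi2 q).
Proof.
move=> cM t1 t2 e1 e2 L uL ML HL.
have [L1 HL1] := finite_mjump cM t1; have [L2 HL2] := finite_mjump cM t2.
(* Jumps of both functions at one point cancel in the sum and may be absent from L; [L'] restores
   them. *)
pose L' := undup (L ++ [seq q <- L1 ++ L2 | `[< M q >]]).
have ML' q : q \in L' -> M q.
  by rewrite mem_undup mem_cat mem_filter => /orP[/ML|/andP[/asboolP]].
rewrite (@eq_count_sub _ _ L L') ?undup_uniq //; first last.
- by move=> q /ML' Mq; exact: HL.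
- by move=> q qL; rewrite mem_undup mem_cat qL.
rewrite (@eq_in_count _ _ (fun q => mjump chi1 q (+) mjump chi2 q)); last first.
  by move=> q /ML' Mq; exact: mjump_addb.
rewrite odd_count_addb.
have o1 : ~~ odd (count (mjump chi1) L').
  apply: e1; rewrite ?undup_uniq // => q Mq jq; rewrite mem_undup mem_cat mem_filter.
  by rewrite mem_cat HL1 // asboolT // orbT.
have o2 : ~~ odd (count (mjump chi2) L').
  apply: e2; rewrite ?undup_uniq // => q Mq jq; rewrite mem_undup mem_cat mem_filter.
  by rewrite mem_cat HL2 // asboolT // !orbT.
by rewrite (negbTE o1) (negbTE o2).
Qed.

Lemma mjump_near0 chi q : M q -> (\forall q' \near q, M q' -> chi q' = false) ->
  mjump chi q = false.
Proof.
move=> Mq; have d0 := arc_dom0 Mq; have [_ g0 _ _ gn] := arcP Mq.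
rewrite -{1}g0 -(gn _ d0 (fun q' => chi q' = false)) => H.
apply: (@jump_near _ _ _ false); apply: filterS H => s.
by rewrite /pull; case: arc_dom => // /(_ isT).
Qed.

(** Halving the radius makes the parameter set compact, and leaves room in which functions supported
    here vanish before the arc ends at [r p]. *)
Definition half_arc p : set X := gam p @` [set s | arc_dom p s /\ `|s| <= r p / 2].

Lemma half_arc_closed p : hausdorff_space X -> M p -> closed (half_arc p).
Proof.
move=> hX Mp; apply: compact_closed => //.
have [rp g0 _ _ gn] := arcP Mp.
rewrite /half_arc; pose a : R := if `[< B p >] then 0 else - (r p / 2).
have -> : [set s | arc_dom p s /\ `|s| <= r p / 2] = [set` `[a, r p / 2]%R].
  apply/seteqP; split => s; rewrite /arc_dom /a /= in_itv /= ler_norml.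
    by case: ifP => _ [? ?]; lra.
  by case: ifP => _ ?; split; lra.
apply: continuous_compact; last exact: segment_compact.
apply/subspace_continuousP => s hs A nA; rewrite /nbhs /= /within /=.
have dom t : [set` `[a, r p / 2]%R] t -> arc_dom p t.
  by rewrite /arc_dom /a /= in_itv /=; case: ifP => _ ?; lra.
have : \forall q \near gam p s, M q -> A q by apply: filterS nA.
by rewrite -gn ?dom //; apply: filterS => t H /dom/H.
Qed.

Lemma half_arc_gam p s : M p -> arc_dom p s ->
  half_arc p (gam p s) <-> `|s| <= r p / 2.
Proof.
move=> Mp ds; have [_ _ ginj _ _] := arcP Mp.
split=> [[t [dt ht] /ginj]|hs]; first by move=> /(_ dt ds) <-.
by exists s.
Qed.

Lemma tame_half_arc p : hausdorff_space X -> M p -> tame (fun q => `[< half_arc p q >]).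
Proof.
move=> hX Mp q Mq; have cA := half_arc_closed hX Mp.
have [[s [ds hs] <-]|nA] := pselect (half_arc p q); last first.
  have : \forall q' \near q, ~ half_arc p q'.
    by move: cA; rewrite -openC openE; apply.
  move=> /nbhs_interior; apply: filterS => q' H _ _.
  have nq' := nbhs_singleton H.
  by apply: filterS H => q'' nq'' _; rewrite !asboolF.
have [rp _ ginj _ gn] := arcP Mp.
rewrite -(gn _ ds (fun q' => q' != gam p s -> \forall q'' \near q', M q'' ->
  `[< half_arc p q'' >] = `[< half_arc p q' >])).
(* Membership in the half arc can change only at the parameters of modulus [r p / 2], which are
   isolated. *)
have H : \forall t \near s, t != s -> `|t| != r p / 2.
  have [->|sr] := eqVneq s (r p / 2).
    have : 0 < r p / 2 < r p / 2 + 1 by lra.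
    by move=> /near_open_itv; apply: filterS => t ht /eqP ne; rewrite gtr0_norm; [apply/eqP|]; lra.
  have [->|sr'] := eqVneq s (- (r p / 2)).
    have : - (r p / 2) - 1 < - (r p / 2) < 0 by lra.
    move=> /near_open_itv; apply: filterS => t ht /eqP ne; rewrite ltr0_norm; last lra.
    by apply/eqP => ?; apply: ne; lra.
  have : - (r p / 2) < s < r p / 2 by move: hs sr sr'; rewrite ler_norml => ? /eqP ? /eqP ?; lra.
  by move=> /near_open_itv; apply: filterS => t ht _; rewrite lt_eqF // ltr_norml.
apply: filterS2 (arc_dom_near ds) H => t Ht H dt nts.
have ts : t != s by apply: contra_neq nts => ->.
have {}H := H ts.
have {Ht} Ht : \forall u \near t, arc_dom p u.
  by case: (Ht ts) => // /nbhs_singleton; rewrite dt.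
rewrite -(gn _ dt (fun q'' => `[< half_arc p q'' >] = `[< half_arc p (gam p t) >])).
have : \forall u \near t, (`|u| <= r p / 2) = (`|t| <= r p / 2).
  case: (ltgtP `|t| (r p / 2)) H => // h _.
    by apply: filterS (near_norm_lt h) => u /= ?; apply/idP; lra.
  by apply: filterS (near_norm_gt h) => u /= ?; apply/negbTE; rewrite -ltNge; lra.
apply: filterS2 Ht => u du E _; apply/asboolP/asboolP; rewrite !half_arc_gam ?E //.
Qed.

(** Pulled back to the whole line, such a function vanishes far out, and its jumps correspond to
    those of chi; the count on the line is [even_jumps]. *)
Lemma even_mjump_half_arc p chi : hausdorff_space X -> M p -> tame chi ->
  (forall q, M q -> chi q -> half_arc p q) -> even_mjump chi.
Proof.
move=> hX Mp tc sc L uL ML HL; have [rp g0 ginj [gM _] gn] := arcP Mp.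
pose h := pull p chi.
have h0 s : r p / 2 < `|s| -> h s = false.
  move=> hs; apply/negP => /andP[ds /(sc _ (gM _ ds))].
  by rewrite half_arc_gam // leNgt hs.
(* Outside the domain the modulus exceeds [r p / 2], except for negative s next to the end of a
   boundary arc, where a whole neighbourhood of s misses the domain. *)
have hn s : ~~ arc_dom p s -> \forall t \near s, h t = false.
  move=> ns; have [s0|s0] := ltP (r p / 2) `|s|.
    by apply: filterS (near_norm_gt s0) => t /= /h0.
  move: ns; rewrite ler_norml in s0; rewrite /arc_dom; case: ifP => Bp; last by move=> /negP[]; lra.
  rewrite negb_and => /orP[]; last by move=> /negP[]; lra.
  rewrite -ltNge => sn; have : s - 1 < s < 0 by lra.
  move=> /near_open_itv; apply: filterS => t ht; apply/negP => /andP[].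
  by rewrite /arc_dom Bp; lra.
have hos s : one_sided h s.
  have [ds|ns] := boolP (arc_dom p s); first exact: pull_one_sided.
  apply: locally_constant_one_sided; rewrite /dnbhs /within /=.
  move: (hn s ns) => /nbhs_interior; apply: filterS => t H _.
  by have E := nbhs_singleton H; apply: filterS H => u ->.
(* The parameter of q on the arc; the default 0 is never met, as [inv] is applied only to points of
   the arc. *)
pose inv q := xget 0 [set s | arc_dom p s /\ gam p s = q].
have invP s : arc_dom p s -> inv (gam p s) = s.
  move=> ds; rewrite /inv; case: xgetP => [t -> [dt]|/(_ s)[]//].
  exact: ginj.
pose L1 := [seq q <- L | `[< half_arc p q >]].
have L1P q : q \in L1 -> exists2 s, arc_dom p s & q = gam p s.
  by rewrite mem_filter => /andP[/asboolP[s [ds _] <-] _]; exists s.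
have -> : count (mjump chi) L = count (mjump chi) L1.
  apply/esym/eq_count_sub; rewrite ?filter_uniq //.
    by move=> q; rewrite mem_filter => /andP[].
  move=> q qL jq; rewrite mem_filter qL andbT; apply/asboolP; apply: contrapT => nA.
  move: jq; rewrite mjump_near0 //; first exact: ML.
  have : \forall q' \near q, ~ half_arc p q'.
    by move: (half_arc_closed hX Mp); rewrite -openC openE; apply.
  by apply: filterS => q' nA' Mq'; apply/negP => /(sc _ Mq').
have -> : count (mjump chi) L1 = count (jump h) (map inv L1).
  rewrite count_map; apply: eq_in_count => q /L1P[s ds ->] /=.
  by rewrite invP // mjump_arc.
apply: (even_jumps hos h0) => [|s js].
  rewrite map_inj_in_uniq ?filter_uniq // => q q' /L1P[s ds ->] /L1P[t dt ->].
  by rewrite !invP // => ->.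
have ds : arc_dom p s.
  by apply: contraTT js => /hn H; rewrite (jump_near H).
have hs : `|s| <= r p / 2.
  apply: contraTT js; rewrite -ltNge => s0; rewrite (@jump_near _ _ _ false) //.
  by apply: filterS (near_norm_gt s0) => t /= /h0.
apply/mapP; exists (gam p s); last by rewrite invP.
rewrite mem_filter HL ?mjump_arc //; last exact: gM.
by rewrite andbT; apply/asboolP; rewrite half_arc_gam.
Qed.

(** Cutting chi along the first half arc writes it as a sum of two tame functions; the jumps created
    by the cut occur in both terms, and additivity of the parity absorbs them. *)
Lemma even_mjump_half_arcs (L : seq X) chi : hausdorff_space X -> compact M ->
  (forall p, p \in L -> M p) -> tame chi ->
  (forall q, M q -> chi q -> exists2 p, p \in L & half_arc p q) -> even_mjump chi.
Proof.
move=> hX cM; elim: L chi => [|p L IH] chi ML tc sc.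
  move=> L' _ ML' _; rewrite (@eq_in_count _ _ pred0) ?count_pred0 // => q /ML' Mq.
  rewrite mjump_near0 //; near=> q' => Mq'; by apply/negP => /(sc _ Mq')[].
have Mp : M p by apply: ML; rewrite inE eqxx.
have tp := tame_half_arc hX Mp.
have -> : chi = (fun q => (chi q && `[< half_arc p q >]) (+)
                          (chi q && ~~ `[< half_arc p q >])).
  by apply/funext => q; case: (chi q) => //=; case: `[< _ >].
apply: even_mjump_addb => //.
- exact: (tame_op andb).
- exact: (tame_op (fun a b => a && ~~ b)).
- apply: (even_mjump_half_arc hX Mp); first exact: (tame_op andb).
  by move=> q _ /andP[_ /asboolP].
- apply: IH.
  + by move=> q qL; apply: ML; rewrite inE qL orbT.
  + exact: (tame_op (fun a b => a && ~~ b)).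
  + move=> q Mq /andP[/(sc _ Mq)[p']].
    rewrite inE => /orP[/eqP ->|]; first by move=> H /asboolP.
    by exists p'.
Unshelve. all: by end_near. Qed.

Lemma even_boundary : hausdorff_space X -> compact M -> B `<=` M ->
  exists L : seq X, [/\ uniq L, forall q, (q \in L) <-> B q & ~~ odd (size L)].
Proof.
move=> hX cM BM; pose chi (q : X) := true.
have tc : tame chi by move=> q Mq; near=> q' => _ _; near=> q''.
have jB q : M q -> mjump chi q = `[< B q >].
  move=> Mq; have [rq _ _ _ _] := arcP Mq.
  have H : - r q < 0 < r q by lra.
  rewrite /mjump; case: asboolP => Bq; last first.
    apply: (@jump_near _ _ _ true); apply: filterS (near_open_itv H) => s hs.
    by rewrite /pull /arc_dom asboolF // hs.
  rewrite /jump (@rlimP _ _ _ true) ?(@llimP _ _ _ false) //.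
    apply/near_leftP; exists 1 => // s hs; rewrite /pull /arc_dom asboolT //=.
    by apply/negbTE; rewrite !negb_and -ltNge; apply/orP; left; apply/orP; left; lra.
  apply/near_rightP; exists (r q) => // s hs; rewrite /pull /arc_dom asboolT //= andbT.
  lra.
(* A half arc is a neighbourhood of its centre only within M, hence the implication. *)
have [|L0 ML0 cov] := compact_finite_cover cM (V := fun p q => M q -> half_arc p q).
  move=> p Mp; have [rp g0 _ _ gn] := arcP Mp; have d0 := arc_dom0 Mp.
  rewrite -{1}g0; apply/(gn _ d0 (half_arc p)).
  have : - (r p / 2) < 0 < r p / 2 by lra.
  move=> /near_open_itv; apply: filterS => t ht dt; apply/half_arc_gam => //.
  by rewrite ler_norml; lra.
have [L1 HL1] := finite_mjump cM tc.
pose L := undup [seq q <- L1 | `[< B q >]].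
have LP q : (q \in L) <-> B q.
  rewrite mem_undup mem_filter; split=> [/andP[/asboolP]//|Bq].
  by rewrite asboolT //= HL1 ?jB ?asboolT //; exact: BM.
exists L; split; rewrite ?undup_uniq //.
have -> : size L = count (mjump chi) L.
  rewrite -count_predT; apply: eq_in_count => q /LP Bq; rewrite jB ?asboolT //.
  exact: BM.
apply: (even_mjump_half_arcs hX cM ML0 tc) => [q Mq _||q /LP/BM//|q Mq].
- by have [p pL] := cov q Mq => /(_ Mq); exists p.
- exact: undup_uniq.
- by rewrite jB // => /asboolP/LP.
Unshelve. all: by end_near. Qed.

End CurveParity.

(** * Strict differentiability of maps between spaces of row vectors *)

Section StrictDerivative.
Context {R : realType}.

Lemma rv_norm_ge m (v : 'rV[R]_m) j : `|v ord0 j| <= `|v|.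
Proof.
rewrite -[leRHS]/(mx_norm v) mx_normrE.
exact: (le_bigmax _ (fun ij : 'I_1 * 'I_m => `|v ij.1 ij.2|) (ord0, j)).
Qed.

Lemma rv_norm_le m (v : 'rV[R]_m) c : 0 <= c ->
  (forall j, `|v ord0 j| <= c) -> `|v| <= c.
Proof.
move=> c0 H; rewrite -[leLHS]/(mx_norm v) mx_normrE.
by apply/bigmax_leP; split => // -[i j] _ /=; rewrite ord1.
Qed.

Lemma rv_mul_bound m n (J : 'M[R]_(m, n)) :
  exists2 K, 0 < K & forall v : 'rV_m, `|v *m J| <= K * `|v|.
Proof.
(* The summand 1 keeps K positive, so that tolerances can be divided by it. *)
pose K := 1 + \sum_j \sum_i `|J i j|.
have S0 : 0 <= \sum_j \sum_i `|J i j| by apply: sumr_ge0 => j _; exact: sumr_ge0.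
exists K; first by rewrite /K; lra.
move=> v; apply: rv_norm_le => [|j]; first by rewrite mulr_ge0 ?normr_ge0 // /K; lra.
rewrite mxE; apply: le_trans (ler_norm_sum _ _ _) _.
apply: (@le_trans _ _ (\sum_i `|v| * `|J i j|)).
  by apply: ler_sum => i _; rewrite normrM ler_wpM2r // rv_norm_ge.
rewrite -mulr_sumr mulrC ler_wpM2r // /K (bigD1 j) //=.
have : 0 <= \sum_(i < n | i != j) \sum_i0 `|J i0 i| by apply: sumr_ge0 => ? _; exact: sumr_ge0.
lra.
Qed.

(** The two-point form of the derivative at a: it carries as much of continuous differentiability as
    a contraction argument uses. Vectors are rows, so J acts from the right. *)
Definition strict_diff m n (f : 'rV[R]_m -> 'rV[R]_n) a (J : 'M[R]_(m, n)) :=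
  forall e, 0 < e -> exists2 d, 0 < d & forall v w,
    `|v - a| < d -> `|w - a| < d -> `|f v - f w - (v - w) *m J| <= e * `|v - w|.

Lemma near_rvP m (a : 'rV[R]_m) (P : set 'rV[R]_m) :
  (\forall v \near a, P v) <-> exists2 d, 0 < d & forall v, `|v - a| < d -> P v.
Proof.
split=> [/nbhs_ballP[d d0 H]|[d d0 H]].
  by exists d => // v va; apply: H; rewrite -ball_normE /= distrC.
by apply/nbhs_ballP; exists d => // v; rewrite -ball_normE /= distrC; exact: H.
Qed.

Lemma strict_diff_near m n (f g : 'rV[R]_m -> 'rV[R]_n) a J :
  (\forall v \near a, f v = g v) -> strict_diff f a J -> strict_diff g a J.
Proof.
move=> /near_rvP[d1 d10 H] sf e e0; have [d d0 Hd] := sf e e0.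
exists (Num.min d d1); first by rewrite lt_min d0.
by move=> v w; rewrite !lt_min => /andP[vd /H <-] /andP[wd /H <-]; exact: Hd.
Qed.

Lemma strict_diff_lipschitz m n (f : 'rV[R]_m -> 'rV[R]_n) a J :
  strict_diff f a J -> exists2 C, 0 < C & exists2 d, 0 < d & forall v w,
    `|v - a| < d -> `|w - a| < d -> `|f v - f w| <= C * `|v - w|.
Proof.
move=> sf; have [K K0 HK] := rv_mul_bound J; have [d d0 Hd] := sf 1 ltr01.
exists (1 + K); first lra; exists d => // v w va wa.
have -> : f v - f w = (f v - f w - (v - w) *m J) + (v - w) *m J by rewrite subrK.
apply: le_trans (ler_normD _ _) _.
by rewrite mulrDl lerD // Hd.
Qed.

Lemma strict_diff_continuous m n (f : 'rV[R]_m -> 'rV[R]_n) a J :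
  strict_diff f a J -> {for a, continuous f}.
Proof.
move=> /strict_diff_lipschitz[C C0 [d d0 H]] A.
move=> /near_rvP[e e0 He]; apply/near_rvP; exists (Num.min d (e / C)).
  by rewrite lt_min d0 divr_gt0.
move=> v; rewrite lt_min => /andP[vd ve]; apply: He.
apply: le_lt_trans (H _ _ vd _) _; first by rewrite subrr normr0.
by rewrite mulrC -ltr_pdivlMr.
Qed.

Lemma strict_diff_comp m n p (f : 'rV[R]_m -> 'rV[R]_n) (g : 'rV[R]_n -> 'rV[R]_p)
    a J K : strict_diff f a J -> strict_diff g (f a) K ->
  strict_diff (g \o f) a (J *m K).
Proof.
move=> sf sg e e0.
have [C C0 [d1 d10 HC]] := strict_diff_lipschitz sf.
have [L L0 HL] := rv_mul_bound K.
have eC : 0 < e / (2 * C) by rewrite divr_gt0 ?mulr_gt0.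
have [d2 d20 Hg] := sg _ eC.
have [|d3 d30 Hf] := sf (e / (2 * L)); first by rewrite divr_gt0 ?mulr_gt0.
exists (Num.min (Num.min d1 (d2 / C)) d3).
  by rewrite !lt_min d10 d30 divr_gt0.
move=> v w; rewrite !lt_min => /andP[/andP[v1 v2] v3] /andP[/andP[w1 w2] w3] /=.
have aa : `|a - a| < d1 by rewrite subrr normr0.
have fv : `|f v - f a| < d2.
  by apply: le_lt_trans (HC _ _ v1 aa) _; rewrite mulrC -ltr_pdivlMr.
have fw : `|f w - f a| < d2.
  by apply: le_lt_trans (HC _ _ w1 aa) _; rewrite mulrC -ltr_pdivlMr.
(* The error of g along the increment of f, controlled by C, and the error of f transported by K,
   controlled by L, each receive half of e. *)
have -> : g (f v) - g (f w) - (v - w) *m (J *m K) =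
   (g (f v) - g (f w) - (f v - f w) *m K) + (f v - f w - (v - w) *m J) *m K.
  by rewrite mulmxA [(f v - f w - _) *m K]mulmxBl addrA subrK.
apply: le_trans (ler_normD _ _) _.
have H1 := le_trans (Hg _ _ fv fw) (ler_wpM2l (ltW eC) (HC _ _ v1 w1)).
have H2 := le_trans (HL _) (ler_wpM2l (ltW L0) (Hf _ _ v3 w3)).
apply: le_trans (lerD H1 H2) _.
suff -> : e / (2 * C) * (C * `|v - w|) + L * (e / (2 * L) * `|v - w|) = e * `|v - w| by [].
by field; rewrite !gt_eqF.
Qed.

Lemma strict_diff_sum (I : finType) m n (f : I -> 'rV[R]_m -> 'rV[R]_n) a J :
  (forall i, strict_diff (f i) a (J i)) ->
  strict_diff (fun v => \sum_i f i v) a (\sum_i J i).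
Proof.
(* The summand 1 covers an empty index type. *)
move=> sf e e0; pose e' := e / (1 + #|I|%:R).
have e'0 : 0 < e' by rewrite divr_gt0 // ltr_pwDl.
have /choice[d Hd] i : exists d, 0 < d /\ forall v w, `|v - a| < d -> `|w - a| < d ->
    `|f i v - f i w - (v - w) *m J i| <= e' * `|v - w|.
  by have [d] := sf i e' e'0; exists d.
exists (\big[Num.min/1]_i d i).
  by apply/bigmin_gtP; split=> [|i _]; [exact: ltr01 | case: (Hd i)].
move=> v w vd wd.
have -> : \sum_i f i v - \sum_i f i w - (v - w) *m (\sum_i J i) =
    \sum_i (f i v - f i w - (v - w) *m J i).
  by rewrite mulmx_sumr -!sumrB.
apply: le_trans (ler_norm_sum _ _ _) _.
apply: (@le_trans _ _ (\sum_(i : I) e' * `|v - w|)).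
  apply: ler_sum => i _; case: (Hd i) => _; apply.
    by apply: lt_le_trans vd _; exact: bigmin_le.
  by apply: lt_le_trans wd _; exact: bigmin_le.
rewrite sumr_const -mulr_natl mulrA ler_wpM2r // /e' mulrA ler_pdivrMr ?ltr_pwDl //.
by rewrite mulrC ler_wpM2l ?ltW //; lra.
Qed.

(* Agreement on open sets accumulating at a suffices for equal derivatives. *)
Lemma strict_diff_unique m n (f g : 'rV[R]_m -> 'rV[R]_n) a J K :
  strict_diff f a J -> strict_diff g a K ->
  (forall d, 0 < d -> exists2 b, `|b - a| < d & \forall v \near b, f v = g v) ->
  J = K.
Proof.
move=> sf sg H.
suff D0 : forall u : 'rV_m, u *m (J - K) = 0.
  apply/row_matrixP => i; apply/eqP; rewrite -subr_eq0 -linearB /= rowE.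
  by rewrite D0.
move=> u; apply/eqP; rewrite -normr_le0; apply/ler_addgt0Pl => e e0; rewrite addr0.
have [u0|u0] := eqVneq u 0; first by rewrite u0 mul0mx normr0 ltW.
have un : 0 < `|u| by rewrite normr_gt0.
have e2 : 0 < e / (2 * `|u|) by rewrite divr_gt0 ?mulr_gt0.
have [d1 d10 H1] := sf _ e2; have [d2 d20 H2] := sg _ e2.
have [|b ba /near_rvP[d3 d30 Hb]] := H (Num.min d1 d2); first by rewrite lt_min d10.
move: ba; rewrite lt_min => /andP[b1 b2].
(* The step [t *: u] then has half the length by which b may move inside both balls around a and
   inside the region of agreement. *)
pose t := Num.min d3 (Num.min (d1 - `|b - a|) (d2 - `|b - a|)) / (2 * `|u|).
have t0 : 0 < t by rewrite divr_gt0 ?mulr_gt0 // !lt_min d30 !subr_gt0 b1.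
have tu : `|t *: u| < Num.min d3 (Num.min (d1 - `|b - a|) (d2 - `|b - a|)).
  rewrite normrZ gtr0_norm // /t invfM mulrA mulfVK ?gt_eqF // ltr_pdivrMr //.
  by rewrite ltr_pMr ?ltr1n // !lt_min d30 !subr_gt0 b1.
move: tu; rewrite !lt_min !ltrBrDr => /and3P[tu3 tu1 tu2].
pose v := t *: u + b.
have va d : `|t *: u| + `|b - a| < d -> `|v - a| < d.
  by apply: le_lt_trans; rewrite /v -addrA; exact: ler_normD.
have vb : v - b = t *: u by rewrite /v addrK.
have fgv : f v = g v by apply: Hb; rewrite vb.
have fgb : f b = g b by apply: Hb; rewrite subrr normr0.
have A1 := H1 _ _ (va _ tu1) b1; have A2 := H2 _ _ (va _ tu2) b2.
rewrite fgv fgb vb in A1; rewrite vb in A2.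
have : `|t *: u *m (J - K)| <= t * e.
  have -> : t *: u *m (J - K) = (g v - g b - t *: u *m K) - (g v - g b - t *: u *m J).
    by rewrite mulmxBr [RHS]addrC [- (_ - _ *m J)]opprB addrA subrK.
  apply: le_trans (ler_normB _ _) _; apply: le_trans (lerD A2 A1) _.
  rewrite normrZ gtr0_norm // -mulrDl.
  suff -> : (e / (2 * `|u|) + e / (2 * `|u|)) * (t * `|u|) = t * e by [].
  by field; rewrite gt_eqF.
by rewrite -scalemxAl normrZ gtr0_norm // ler_pM2l.
Qed.

Lemma strict_diff_id m (a : 'rV[R]_m) : strict_diff id a 1%:M.
Proof.
move=> e e0; exists 1 => // v w _ _; rewrite mulmx1 subrr normr0.
by apply: mulr_ge0 => //; exact: ltW.
Qed.

Lemma strict_diff_jacobian m n (f : 'rV[R]_m -> 'rV[R]_n) a J :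
  strict_diff f a J -> jacobian f a = J.
Proof.
move=> sf; have [K K0 HK] := rv_mul_bound J.
have cJ : continuous (mulmxr J : {linear 'rV[R]_m -> 'rV[R]_n}).
  move=> v; apply: (@strict_diff_continuous _ _ _ _ J) => e e0; exists 1 => // x y _ _ /=.
  by rewrite mulmxBl subrr normr0; apply: mulr_ge0 => //; exact: ltW.
have D : 'd f a = (mulmxr J : {linear 'rV[R]_m -> 'rV[R]_n}) :> ('rV[R]_m -> 'rV[R]_n).
  apply: diff_unique => //; apply/eqaddoP => _/posnumP[e].
  have [d d0 Hd] := sf e%:num (gt0 e).
  apply/near_rvP; exists d => // v; rewrite subr0 => vd /=.
  rewrite -[leLHS]/(`|f (v + a) - (f a + v *m J)|).
  have := Hd (v + a) a; rewrite addrK subrr normr0 => /(_ vd d0).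
  by rewrite opprD addrA.
apply/row_matrixP => i; rewrite !rowE /jacobian mul_rV_lin1 D.
by [].
Qed.

End StrictDerivative.

(** Completeness of the space of row vectors, for the Banach fixed point theorem in
    [local_inverse]. *)
HB.instance Definition _ (R : realType) (m n : nat) :=
  Uniform_isComplete.Build 'M[R]_(m, n) cauchy_cvg.

(** * Inverse functions by contraction, and implicit curves *)

Section ImplicitCurve.
Context {R : realType}.

Lemma is_derive_line m n (f : 'rV[R]_m -> 'rV[R]_n) (w u : 'rV[R]_m) t j :
  differentiable f (w + t *: u) ->
  is_derive t 1 (fun s : R => f (w + s *: u) ord0 j) (('D_u f (w + t *: u)) ord0 j).
Proof.
move=> df.
have @c : {linear 'rV[R]_n -> R}.
  by exists (fun N : 'rV[R]_n => N ord0 j); do 2![eexists]; do ?[constructor];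
     rewrite ?mxE// => ? *; rewrite ?mxE//; move=> ?; rewrite !mxE.
have cc : continuous c by exact: coord_continuous.
have H1 : is_diff t (fun s : R => w + s *: u) (fun s => s *: u).
  by apply: is_diff_eq; rewrite add0r.
have H2 : is_diff (w + t *: u) f ('d f (w + t *: u)) by exact: DiffDef.
have H3 : is_diff (f (w + t *: u)) c c.
  by apply: DiffDef; [exact: linear_differentiable | exact: diff_lin].
have H := is_diff_comp (is_diff_comp H1 H2) H3.
have E : (fun s : R => f (w + s *: u) ord0 j) = c \o (f \o (fun s : R => w + s *: u)) by [].
rewrite E; apply: DeriveDef; first exact: diff_derivable.
by rewrite deriveE // diff_val /= scale1r deriveE.
Qed.

Lemma mulmx_entryB m n (u : 'rV[R]_m) (A B : 'M[R]_(m, n)) j :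
  (u *m A) ord0 j - (u *m B) ord0 j = \sum_i u ord0 i * (A i j - B i j).
Proof. by rewrite !mxE -sumrB; apply: eq_bigr => i _; rewrite mulrBr. Qed.

Lemma rv_entryB n (a b : 'rV[R]_n) j : (a - b) ord0 j = a ord0 j - b ord0 j.
Proof. by rewrite !mxE. Qed.

Lemma jacobian_entry m n (f : 'rV[R]_m -> 'rV[R]_n) x i j : differentiable f x ->
  jacobian f x i j = ('D_(delta_mx ord0 i) f x) ord0 j.
Proof. by move=> df; rewrite deriveEjacobian // -rowE [RHS]mxE. Qed.

Lemma jacobian_mul_dist m n (f : 'rV[R]_m -> 'rV[R]_n) x a (u : 'rV[R]_m) j e :
  differentiable f x -> differentiable f a ->
  (forall i, `|'D_(delta_mx ord0 i) f x - 'D_(delta_mx ord0 i) f a| <= e) ->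
  `|(u *m jacobian f x) ord0 j - (u *m jacobian f a) ord0 j| <= m%:R * e * `|u|.
Proof.
move=> dx da H; rewrite mulmx_entryB.
apply: le_trans (ler_norm_sum _ _ _) _.
apply: (@le_trans _ _ (\sum_(i < m) `|u| * e)).
  apply: ler_sum => i _; rewrite normrM.
  have -> : jacobian f x i j - jacobian f a i j =
      ('D_(delta_mx ord0 i) f x - 'D_(delta_mx ord0 i) f a) ord0 j.
    exact: etrans (congr2 (fun b c => b - c) (jacobian_entry i j dx) (jacobian_entry i j da))
      (esym (rv_entryB _ _ _)).
  by rewrite ler_pM ?rv_norm_ge //; apply: le_trans (rv_norm_ge _ _) (H i).
by rewrite sumr_const card_ord -[leLHS]mulr_natl mulrA mulrAC.
Qed.

(** The mean value theorem on the segment from w to v, for each coordinate of f minus its linear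
    part. The intermediate point depends on the coordinate, which is harmless for the sup norm. *)
Lemma C1_strict_diff m n (U : set 'rV[R]_m) (f : 'rV[R]_m -> 'rV[R]_n) a :
  open U -> U a -> Ck 1 U f -> strict_diff f a (jacobian f a).
Proof.
move=> oU Ua [df cf] e e0; pose e' := e / (1 + m%:R).
have e'0 : 0 < e' by rewrite divr_gt0 // ltr_pwDl.
have : \forall x \near a, U x /\ forall i : 'I_m,
    `|'D_(delta_mx ord0 i) f x - 'D_(delta_mx ord0 i) f a| < e'.
  have Un : \forall x \near a, U x by move: oU; rewrite openE; apply.
  suff : \forall x \near a, forall i : 'I_m,
      `|'D_(delta_mx ord0 i) f x - 'D_(delta_mx ord0 i) f a| < e'.
    by apply: filterS2 Un => x.
  have cfi (i : 'I_m) : \forall x \near a,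
      `|'D_(delta_mx ord0 i) f x - 'D_(delta_mx ord0 i) f a| < e'.
    have /cvgrPdist_lt/(_ e' e'0) := cf (delta_mx ord0 i) a Ua.
    by apply: filterS => x; rewrite (distrC ('D_(delta_mx ord0 i) f a)).
  by have H := @filter_forall _ _ _ (nbhs a) _ cfi; exact: H.
move=> /near_rvP[d d0 H]; exists d => // v w vd wd.
set u := v - w.
have seg t : 0 <= t <= 1 -> `|w + t *: u - a| < d.
  move=> /andP[t0 t1]; have -> : w + t *: u - a = (1 - t) *: (w - a) + t *: (v - a).
    by apply/rowP => k; rewrite /u !mxE; ring.
  apply: le_lt_trans (ler_normD _ _) _; rewrite !normrZ !ger0_norm //; last lra.
  have : (1 - t) * `|w - a| <= (1 - t) * Num.max `|v - a| `|w - a|.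
    by rewrite ler_wpM2l ?subr_ge0 // le_max lexx orbT.
  have : t * `|v - a| <= t * Num.max `|v - a| `|w - a|.
    by rewrite ler_wpM2l // le_max lexx.
  have : Num.max `|v - a| `|w - a| < d by rewrite gt_max vd.
  lra.
apply: rv_norm_le => [|j]; first by apply: mulr_ge0 => //; exact: ltW.
pose p t := f (w + t *: u) ord0 j - t * (u *m jacobian f a) ord0 j.
pose dp t := ('D_u f (w + t *: u)) ord0 j - (u *m jacobian f a) ord0 j.
have dp_is (t : R) : 0 <= t <= 1 -> is_derive t 1 p (dp t).
  move=> t01; have [Ut _] := H _ (seg t t01).
  have := is_derive_line j (df _ Ut) => D1.
  have D2 : is_derive t 1 (fun s : R => s * (u *m jacobian f a) ord0 j) ((u *m jacobian f a) ord0 j).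
    by apply: is_derive_eq; rewrite scaler0 add0r /GRing.scale /= mulr1.
  exact: is_deriveB.
have [||c c01 Ec] := @MVT_segment _ p dp 0 1 ler01.
- by move=> t; rewrite in_itv /= => t01; apply: dp_is; lra.
- apply: derivable_within_continuous => t; rewrite in_itv /= => t01.
  by have [] := dp_is _ t01.
rewrite in_itv /= in c01.
have -> : (f v - f w - u *m jacobian f a) ord0 j = dp c.
  move: Ec; rewrite subr0 mulr1 => <-.
  by rewrite /p scale1r scale0r addr0 mul0r subr0 mul1r /u [w + _]addrC subrK !mxE addrAC.
have [Uc Hc] := H _ (seg c c01).
rewrite /dp deriveEjacobian; last exact: df.
apply: le_trans (jacobian_mul_dist u j (df _ Uc) (df _ Ua) (fun i => ltW (Hc i))) _.
rewrite ler_wpM2r // /e' mulrA ler_pdivrMr ?ltr_pwDl // mulrC ler_wpM2l ?ltW //; lra.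
Qed.

Lemma local_inverse m (Phi : 'rV[R]_m -> 'rV[R]_m) K rho0 :
  strict_diff Phi 0 K -> K \in unitmx -> Phi 0 = 0 -> 0 < rho0 ->
  exists rho C delta, [/\ 0 < rho <= rho0, 0 < C, 0 < delta,
    forall v w, `|v| < rho -> `|w| < rho -> `|v - w| <= C * `|Phi v - Phi w| &
    forall z, `|z| < delta -> exists2 v, `|v| < rho & Phi v = z].
Proof.
move=> sP uK P0 r0.
have [L L0 HL] := rv_mul_bound (invmx K).
(* Multiplied by the bound L of [invmx K], this tolerance becomes the contraction factor 1/2. *)
have e0 : 0 < 1 / (2 * L) by rewrite divr_gt0 ?mulr_gt0.
have [d d0 Hd] := sP _ e0.
pose rho := Num.min d rho0.
have rho_gt0 : 0 < rho by rewrite lt_min d0.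
have rd : rho <= d by rewrite ge_min lexx.
have contr v w : `|v| < rho -> `|w| < rho ->
    `|(v - w) - (Phi v - Phi w) *m invmx K| <= 1 / 2 * `|v - w|.
  move=> vr wr; have -> : (v - w) - (Phi v - Phi w) *m invmx K =
      - ((Phi v - Phi w - (v - w) *m K) *m invmx K).
    by rewrite [(_ - _ *m K) *m _]mulmxBl mulmxK // opprB.
  rewrite normrN; apply: le_trans (HL _) _.
  have := Hd v w; rewrite !subr0 => /(_ (lt_le_trans vr rd) (lt_le_trans wr rd)) h.
  apply: le_trans (ler_wpM2l (ltW L0) h) _.
  suff -> : L * (1 / (2 * L) * `|v - w|) = 1 / 2 * `|v - w| by [].
  by field; rewrite gt_eqF.
(* The factor [2 * L] comes from moving the contracted half of [v - w] to the other side;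
   [rho / (4 * L)] makes the norm of [T 0] at most [rho / 4], so that [T] preserves the ball of
   radius [rho / 2]. *)
exists rho, (2 * L), (rho / (4 * L)); split.
- by rewrite rho_gt0 ge_min lexx orbT.
- by rewrite mulr_gt0.
- by rewrite divr_gt0 ?mulr_gt0.
- move=> v w vr wr; have h := contr v w vr wr; have h' := HL (Phi v - Phi w).
  have : `|v - w| <= `|(v - w) - (Phi v - Phi w) *m invmx K| + `|(Phi v - Phi w) *m invmx K|.
    by rewrite -{1}[v - w](subrK ((Phi v - Phi w) *m invmx K)) ler_normD.
  lra.
move=> z zd.
pose T v := v - (Phi v - z) *m invmx K.
pose U := [set v : 'rV[R]_m | `|v| <= rho / 2].
have Ur v : U v -> `|v| < rho by rewrite /U /= => ?; lra.
have TT v w : T v - T w = (v - w) - (Phi v - Phi w) *m invmx K.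
  rewrite /T !mulmxBl.
  move: (Phi v *m _) (Phi w *m _) (z *m _) => a b c.
  by apply/rowP => j; rewrite !mxE; ring.
have TU : set_fun U U T.
  move=> v Uv; have vr := Ur v Uv.
  have h0 : `|(0 : 'rV[R]_m)| < rho by rewrite normr0.
  have := contr v 0 vr h0; rewrite -TT subr0 => h.
  have T0 : `|T 0| <= rho / 4.
    rewrite /T P0 !sub0r mulNmx opprK; apply: le_trans (HL _) _.
    rewrite mulrC -ler_pdivlMr //; apply: le_trans (ltW zd) _.
    by rewrite invfM mulrA.
  have : `|T v| <= `|T v - T 0| + `|T 0| by rewrite -{1}[T v](subrK (T 0)) ler_normD.
  move: Uv; rewrite /U /=; lra.
have cU : closed U.
  rewrite (_ : U = (fun v : 'rV[R]_m => `|v|) @^-1` [set x | x <= rho / 2]) //.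
  apply: closed_comp; last exact: closed_le.
  by move=> v _; exact: norm_continuous.
pose Tf : {fun U >-> U} := mkfun TU.
have ctr : is_contraction Tf.
  exists (1 / 2)%:nng; split; first by rewrite /=; lra.
  move=> [v w] /= [Uv Uw]; rewrite TT; exact: contr (Ur _ Uv) (Ur _ Uw).
have [|v Uv vT] := banach_fixed_point ctr cU.
  by exists 0; rewrite /U /= normr0; lra.
exists v; first exact: Ur.
move: vT; rewrite /= /T => /eqP; rewrite -subr_eq0 opprB addrC subrK => /eqP E.
apply/eqP; rewrite -subr_eq0 -[Phi v - z](mulmxK uK) -[_ *m K *m _]mulmxA.
by rewrite mulmxV // mulmx1 -[Phi v - z](mulmxKV uK) E mul0mx.
Qed.

(** The curve is the local inverse of v |-> (v_i, G v) along the axis (s, 0), so coordinate i is its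
    parameter. *)
Lemma implicit_curve n (G : 'rV[R]_(1 + n) -> 'rV[R]_n) (J : 'M[R]_(1 + n, n))
    (i : 'I_(1 + n)) rho0 :
  strict_diff G 0 J -> G 0 = 0 ->
  row_mx (delta_mx i ord0 : 'cV_(1 + n)) J \in unitmx -> 0 < rho0 ->
  exists rho r (kappa : R -> 'rV[R]_(1 + n)), [/\ 0 < rho <= rho0, 0 < r, kappa 0 = 0,
    forall s : R, `|s| < r -> [/\ `|kappa s| < rho, kappa s ord0 i = s,
      G (kappa s) = 0 & {for s, continuous kappa}] &
    forall v : 'rV[R]_(1 + n), `|v| < rho -> `|v ord0 i| < r -> G v = 0 -> kappa (v ord0 i) = v].
Proof.
move=> sG G0 uK r0.
set K := row_mx _ J in uK.
pose Phi (v : 'rV[R]_(1 + n)) : 'rV[R]_(1 + n) := row_mx (v ord0 i)%:M (G v).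
have dE (v : 'rV[R]_(1 + n)) : v *m (delta_mx i ord0 : 'cV_(1 + n)) = (v ord0 i)%:M.
  by rewrite -colE [LHS]mx11_scalar mxE.
have sPhi : strict_diff Phi 0 K.
  move=> e e0; have [d d0 Hd] := sG e e0; exists d => // v w vd wd.
  have -> : Phi v - Phi w - (v - w) *m K = row_mx 0 (G v - G w - (v - w) *m J).
    rewrite /Phi /K mul_mx_row dE !opp_row_mx !add_row_mx; congr row_mx.
    by rewrite -!raddfB /= !mxE subrr raddf0.
  apply: rv_norm_le => [|j]; first by apply: mulr_ge0 => //; exact: ltW.
  rewrite mxE; case: (fintype.split j) => k; last by apply: le_trans (rv_norm_ge _ _) _; exact: Hd.
  by rewrite mxE normr0; apply: mulr_ge0 => //; exact: ltW.
have Phi0 : Phi 0 = 0 by rewrite /Phi G0 mxE raddf0 row_mx0.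
have [rho [C [r [rhoP C0 r_gt0 inj sur]]]] := local_inverse sPhi uK Phi0 r0.
pose z (s : R) : 'rV[R]_(1 + n) := row_mx s%:M 0.
have zB s t : `|z s - z t| <= `|s - t|.
  apply: rv_norm_le => // j; rewrite /z opp_row_mx add_row_mx subr0 -raddfB /= mxE.
  case: (fintype.split j) => k; last by rewrite mxE normr0.
  by rewrite mxE [k]ord1 mulr1n.
have z0 : z 0 = 0 by rewrite /z raddf0 row_mx0.
have zn s : `|z s| <= `|s| by have := zB s 0; rewrite z0 !subr0.
have /choice[kappa Hk] s : exists v, `|s| < r -> `|v| < rho /\ Phi v = z s.
  have [sr|sr] := boolP (`|s| < r); last by exists 0.
  by have [v ? ?] := sur (z s) (le_lt_trans (zn s) sr); exists v.
have uniq v w : `|v| < rho -> `|w| < rho -> Phi v = Phi w -> v = w.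
  move=> vr wr E; apply/eqP; rewrite -subr_eq0 -normr_le0.
  by apply: le_trans (inj _ _ vr wr) _; rewrite E subrr normr0 mulr0.
exists rho, r, kappa; split => //.
- have [|k1 k2] := Hk 0; first by rewrite normr0.
  apply: uniq => //; first by rewrite normr0; case/andP: rhoP.
  by rewrite k2 z0 Phi0.
- move=> s sr; have [k1 k2] := Hk s sr; have [E1 E2] := eq_row_mx k2.
  split => //.
    by have := congr1 (fun A : 'M[R]_1 => A ord0 ord0) E1; rewrite !mxE !eqxx !mulr1n.
  move=> A /near_rvP[e e_gt0 He].
  have : \forall t \near s, `|t| < r /\ `|t - s| < e / C.
    have cn : \forall t \near s, `|t - s| < e / C.
      by apply/nbhs_ballP; exists (e / C); rewrite /= ?divr_gt0 // => t; rewrite /ball /= distrC.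
    by apply: filterS2 (near_norm_lt sr) cn.
  apply: filterS => t [tr ts]; apply: He; have [k1' k2'] := Hk t tr.
  apply: le_lt_trans (inj _ _ k1' k1) _; rewrite k2 k2'.
  apply: le_lt_trans (ler_wpM2l (ltW C0) (zB _ _)) _.
  by rewrite mulrC -ltr_pdivlMr.
- move=> v vr ir Gv; have [k1 k2] := Hk _ ir.
  by apply: uniq => //; rewrite k2 /Phi Gv.
Qed.

End ImplicitCurve.

(** * Finite group actions and their differentials at a fixed point *)

Section GroupActions.
Context {R : realType}.

Lemma smooth_on_strict_diff m n (D : set 'rV[R]_m) (f : 'rV[R]_m -> 'rV[R]_n) a :
  open D -> D a -> smooth_on D f -> strict_diff f a (jacobian f a).
Proof.
move=> oD Da /(_ a Da)[g [U [oU Ua sg E]]].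
have sf : strict_diff f a (jacobian g a).
  apply: strict_diff_near (C1_strict_diff oU Ua (sg 1%N)).
  have : open (U `&` D) by exact: openI.
  rewrite openE => /(_ a (conj Ua Da)); apply: filterS => v vUD.
  by rewrite E // inE.
by rewrite (strict_diff_jacobian sf).
Qed.

(* The orbit sum of the action is locally injective at a and invariant. *)
Lemma trivial_action_near m (gT : finGroupType) (D : set 'rV[R]_m)
    (act : gT -> 'rV[R]_m -> 'rV[R]_m) a :
  open D -> D a ->
  (forall g h w, D w -> act (g * h)%g w = act g (act h w)) ->
  (forall g, act g a = a) -> (forall g, strict_diff (act g) a 1%:M) ->
  forall g, \forall w \near a, act g w = w.
Proof.
move=> oD Da actM acta sact g.
have := strict_diff_sum sact; set phi := fun v => _ => sphi.
(* The orbit sum has derivative [#|gT|] times the identity, so any tolerance below 1 gives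
   injectivity near a. *)
have [|d d0 Hd] := sphi (1 / 2); first lra.
have Dn : \forall w \near a, D w by move: oD; rewrite openE; apply.
have n1 : \forall w \near a, `|w - a| < d by apply/near_rvP; exists d.
have n2 : \forall w \near a, `|act g w - a| < d.
  have nd : \forall v \near act g a, `|v - a| < d by rewrite acta; apply/near_rvP; exists d.
  exact: strict_diff_continuous (sact g) _ nd.
apply: filterS3 Dn n1 n2 => w Dw w1 w2.
have phig : phi (act g w) = phi w.
  rewrite /phi [RHS](reindex_inj (mulIg g)) /=.
  by apply: eq_bigr => h _; rewrite actM.
have := Hd _ _ w2 w1; rewrite phig subrr sub0r normrN sumr_const.
have -> : (act g w - w) *m (1%:M *+ #|gT|) = (act g w - w) *+ #|gT|.
  by rewrite -scaler_nat -scalemxAr mulmx1 scaler_nat.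
rewrite normrMn -mulr_natl => H; apply/eqP; rewrite -subr_eq0 -normr_le0.
have : 1 * `|act g w - w| <= #|gT|%:R * `|act g w - w|.
  by rewrite ler_wpM2r // ler1n; apply/card_gt0P; exists g.
lra.
Qed.

(** The set of points near which the whole group acts trivially is open and contains 0. A limit
    point of it in D is fixed, by continuity, and has identity differentials, by agreement on open
    sets accumulating there; hence it belongs to the set, and connectedness concludes. *)
Lemma trivial_action m (gT : finGroupType) (D : set 'rV[R]_m)
    (act : gT -> 'rV[R]_m -> 'rV[R]_m) :
  open D -> connected D -> D 0 ->
  (forall g h w, D w -> act (g * h)%g w = act g (act h w)) ->
  (forall g, act g 0 = 0) -> (forall g, smooth_on D (act g)) ->
  (forall g, jacobian (act g) 0 = 1%:M) ->
  forall g w, D w -> act g w = w.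
Proof.
move=> oD cD D0 actM act0 sact J0 g w Dw.
have sd h v : D v -> strict_diff (act h) v (jacobian (act h) v).
  by move=> Dv; exact: smooth_on_strict_diff oD Dv (sact h).
pose T (v : 'rV[R]_m) := `[< forall h, \forall u \near v, act h u = u >].
have T0 : T 0.
  by apply/asboolP; apply: (trivial_action_near oD) => // h; rewrite -(J0 h); exact: sd.
have Tloc v : D v -> \forall u \near v, T u = T v.
  move=> Dv; have [/asboolP Tv|nTv] := boolP (T v).
    have H h : \forall u \near v, \forall x \near u, act h x = x.
      exact: nbhs_interior (Tv h).
    have {}H := @filter_forall _ _ _ (nbhs v) (nbhs_filter v) H.
    by apply: filterS H => u Hu; apply/asboolP.
  apply: contrapT => nn; move/negP: nTv; apply.
  have acc d : 0 < d -> exists2 b, `|b - v| < d & T b.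
    move=> d0; apply: contrapT => nb; apply: nn; apply/near_rvP; exists d => // u ud.
    by apply/negbTE/negP => Tu; apply: nb; exists u.
  apply/asboolP; apply: (trivial_action_near oD) => // h.
    have [C C0 [d d0 Hd]] := strict_diff_lipschitz (sd h v Dv).
    apply/eqP; rewrite -subr_eq0 -normr_le0; apply/ler_addgt0Pl => e e0; rewrite addr0.
    have [|b] := acc (Num.min d (e / (C + 1))).
      by rewrite lt_min d0 divr_gt0 // addr_gt0.
    rewrite lt_min => /andP[bd be] /asboolP/(_ h)/nbhs_singleton hb.
    have := Hd b v bd; rewrite subrr normr0 hb => /(_ d0) H.
    have : `|act h v - v| <= `|b - act h v| + `|b - v|.
      by rewrite (distrC b (act h v)); exact: ler_distD.
    move: be; rewrite ltr_pdivlMr ?addr_gt0 //; lra.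
  have -> : 1%:M = jacobian (act h) v; last exact: sd.
  apply: strict_diff_unique (strict_diff_id v) (sd h v Dv) _ => d /acc[b bd /asboolP/(_ h) Tb].
  by exists b => //; apply: filterS Tb => u ->.
have Tw : T w = T 0 by exact: connected_locally_constant cD Tloc w 0 Dw D0.
by move: Tw; rewrite T0 => /asboolP/(_ g)/nbhs_singleton.
Qed.

(* The average P of the J g satisfies P *m J g = P and P *m D = D. *)
Lemma rank_invariants n k (gT : finGroupType) (J : gT -> 'M[R]_n) (D : 'M[R]_(n, k)) :
  (forall g h, J (g * h)%g = J h *m J g) -> (forall g, J g *m D = D) ->
  (\rank D <= \rank (\bigcap_g eigenspace (J g) 1)%MS)%N.
Proof.
move=> JM JD; pose P := (#|gT|%:R^-1 : R) *: \sum_g J g.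
have c0 : #|gT|%:R != 0 :> R.
  by rewrite pnatr_eq0 -lt0n; apply/card_gt0P; exists 1%g.
have PD : P *m D = D.
  rewrite /P -scalemxAl mulmx_suml (eq_bigr (fun=> D)) => [|g _]; last exact: JD.
  by rewrite sumr_const -[D *+ _]scaler_nat scalerA mulVf // scale1r.
have PJ g : P *m J g = P.
  rewrite /P -scalemxAl mulmx_suml; congr (_ *: _).
  rewrite [RHS](reindex_inj (mulgI g)) /=.
  by apply: eq_bigr => h _; rewrite JM.
rewrite -{1}PD; apply: leq_trans (mxrankM_maxl _ _) _; apply: mxrankS.
by apply/sub_bigcapmxP => g _; apply/eigenspaceP; rewrite PJ scale1r.
Qed.

Lemma full_invariants n (gT : finGroupType) (J : gT -> 'M[R]_n) :
  \rank (\bigcap_g eigenspace (J g) 1)%MS = n -> forall g, J g = 1%:M.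
Proof.
move=> rn g; have : (1%:M <= (\bigcap_g eigenspace (J g) 1)%MS)%MS.
  by rewrite sub1mx /row_full rn.
by move=> /sub_bigcapmxP/(_ g isT)/eigenspaceP; rewrite mul1mx scale1r.
Qed.

Lemma chart_isotropy_trivial n (T : topologicalType) (c : chart R T n) :
  is_chart false c ->
  \rank (\bigcap_(g : grp c) eigenspace (jacobian (Defs.act g) 0) 1)%MS = n ->
  forall g : grp c, g = 1%g.
Proof.
move=> hc rn g; apply: (act_effective hc) => w Dw.
have oD : open (Defs.dom c) by case: (dom_open hc) => // -[].
apply: (trivial_action oD (dom_connected hc) (dom0 hc)) => //.
- exact: (Defs.actM hc).
- exact: (act_fix0 hc).
- exact: (act_smooth hc).
- exact: full_invariants rn.
Qed.

(** Differentiating the invariance of H at the fixed point 0 gives [J g *m D = D], and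
    differentiating the action law makes J multiplicative in reversed order, as vectors are rows. *)
Lemma chart_rank_invariants n k (T : topologicalType) (c : chart R T n)
    (H : 'rV[R]_n -> 'rV[R]_k) (D : 'M[R]_(n, k)) :
  is_chart false c -> strict_diff H 0 D ->
  (forall g : grp c, \forall w \near (0 : 'rV[R]_n), H (Defs.act g w) = H w) ->
  (\rank D <= \rank (\bigcap_(g : grp c) eigenspace (jacobian (Defs.act g) 0%R) 1%R)%MS)%N.
Proof.
move=> hc sH HH.
have oD : open (Defs.dom c) by case: (dom_open hc) => // -[].
have D0 := dom0 hc.
have sa g : strict_diff (@Defs.act _ _ _ c g) 0 (jacobian (Defs.act g) 0).
  exact: smooth_on_strict_diff oD D0 (act_smooth hc g).
have comp k' (f : 'rV[R]_n -> 'rV[R]_k') K g : strict_diff f 0 K ->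
    strict_diff (f \o @Defs.act _ _ _ c g) 0 (jacobian (Defs.act g) 0 *m K).
  by move=> sf; apply: strict_diff_comp; rewrite ?(act_fix0 hc).
apply: rank_invariants => [g h|g].
  apply: strict_diff_unique (sa _) (comp _ _ _ h (sa g)) _ => d d0.
  exists 0; first by rewrite subrr normr0.
  have : \forall w \near (0 : 'rV[R]_n), Defs.dom c w by move: oD; rewrite openE; apply.
  by apply: filterS => w Dw; rewrite (Defs.actM hc).
apply: strict_diff_unique (comp _ _ _ g sH) sH _ => d d0.
exists 0; last exact: HH.
by rewrite subrr normr0.
Qed.

End GroupActions.

(** * Charts with trivial group, and the arcs they contain *)

Section Charts.
Context {R : realType}.

(** The columns of J span a space of dimension n, which cannot contain all 1 + n unit vectors. *)
Lemma row_complement n (J : 'M[R]_(1 + n, n)) : \rank J = n ->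
  exists i : 'I_(1 + n), row_mx (delta_mx i ord0 : 'cV_(1 + n)) J \in unitmx.
Proof.
move=> rJ; apply: contrapT => nu.
have sub (i : 'I_(1 + n)) : ((delta_mx ord0 i : 'rV[R]_(1 + n)) <= J^T)%MS.
  apply: contrapT => ni; apply: nu; exists i.
  rewrite -unitmx_tr tr_row_mx trmx_delta -row_full_unit -col_leq_rank.
  rewrite -addsmxE; have : (\rank J^T < \rank ((delta_mx ord0 i : 'rV[R]_(1 + n)) + J^T)%MS)%N.
    apply: rank_ltmx; rewrite ltmxE addsmxSr /=; apply/negP => h; apply: ni.
    exact: submx_trans (addsmxSl _ _) h.
  by rewrite mxrank_tr rJ.
have : (1%:M <= J^T)%MS by apply/row_subP => i; rewrite row1.
by move=> /mxrankS; rewrite mxrank1 mxrank_tr rJ ltnn.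
Qed.

(** The case of the time coordinate, [dsubmx J] being the differential along the slice; the matrix
    is block triangular. *)
Lemma row_complement0 n (J : 'M[R]_(1 + n, n)) : dsubmx J \in unitmx ->
  row_mx (delta_mx (lshift n ord0) ord0 : 'cV_(1 + n)) J \in unitmx.
Proof.
move=> uD; rewrite -[J]vsubmxK.
have -> : delta_mx (lshift n ord0) ord0 = col_mx 1%:M 0 :> 'cV[R]_(1 + n).
  apply/colP => i; rewrite !mxE; case: splitP => k ik; rewrite !mxE ?eqxx ?andbT.
    by rewrite -val_eqE /= ik [k]ord1.
  by rewrite -val_eqE /= ik.
by rewrite -block_mxEh unitmxE det_ublock det1 mul1r -unitmxE.
Qed.

Lemma strict_diff_linear m n (A : 'M[R]_(m, n)) (a : 'rV[R]_m) :
  strict_diff (fun v => v *m A) a A.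
Proof.
move=> e e0; exists 1 => // v w _ _; rewrite mulmxBl subrr normr0.
by apply: mulr_ge0 => //; exact: ltW.
Qed.

Context {X : topologicalType} {m : nat}.
Implicit Types (Q : chart R X m) (S : set 'rV[R]_m).

Lemma chart_phi_continuous bd Q (V : set X) : is_chart bd Q -> open V ->
  relopen (Defs.dom Q) (Defs.dom Q `&` phi Q @^-1` V).
Proof.
move=> hQ oV; have [H _] := phi_quotient hQ (@subIsetr _ V (cimage Q)).
have -> : Defs.dom Q `&` phi Q @^-1` V = Defs.dom Q `&` phi Q @^-1` (V `&` cimage Q).
  by apply/seteqP; split => v [Dv Vv]; split => //; [split => //; exists v | case: Vv].
by apply: H; apply: openI => //; exact: (phi_open hQ).
Qed.

Lemma chart_phi_inj bd Q v w : is_chart bd Q -> (forall g : grp Q, g = 1%g) ->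
  Defs.dom Q v -> Defs.dom Q w -> phi Q v = phi Q w -> v = w.
Proof.
move=> hQ g1 Dv Dw /(phi_fibre hQ Dv Dw)[g ->].
by rewrite (g1 g) (Defs.act1 hQ).
Qed.

(** The quotient topology only sees sets saturated under the group; for a trivial group every part
    of the domain is saturated. *)
Lemma chart_phi_image_open bd Q S : is_chart bd Q -> (forall g : grp Q, g = 1%g) ->
  relopen (Defs.dom Q) S -> open (phi Q @` S).
Proof.
move=> hQ g1 oS; have SD : S `<=` Defs.dom Q by case: oS => V _ -> v [].
apply/(phi_quotient hQ); first by move=> _ [v /SD Dv <-]; exists v.
rewrite (_ : _ `&` _ = S) //; apply/seteqP; split => [v [Dv [w Sw /=]]|v Sv].
  by move=> /(chart_phi_inj hQ g1 (SD _ Sw) Dv) <-.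
by split; [exact: SD | exists v].
Qed.

(** As the domain of a chart with the same action, S is stable under the group, hence it is the full
    preimage of its open image. *)
Lemma chart_restrict_relopen bd Q S : is_chart bd Q -> is_chart bd (Defs.restrict Q S) ->
  S `<=` Defs.dom Q -> relopen (Defs.dom Q) S.
Proof.
move=> hQ hS SD; have := chart_phi_continuous hQ (phi_open hS).
rewrite (_ : _ `&` _ = S) //; apply/seteqP; split => [v [Dv [w Sw /=]]|v Sv].
  move=> /(phi_fibre hQ (SD _ Sw) Dv)[g ->]; exact: (Defs.act_dom hS).
by split; [exact: SD | exists v].
Qed.

End Charts.

Lemma open_near (T : topologicalType) (A : set T) x : open A -> A x -> \forall y \near x, A y.
Proof. by rewrite openE => oA; exact: oA. Qed.

(** The zero curve of G lives in a full ball. Since its parameter is the very coordinate whose sign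
    decides membership in the chart domain at a boundary point, restricting to the domain turns the
    parameter range into [arc_dom]. *)
Lemma chart_arc (R : realType) n (X : topologicalType) (Q : chart R X (1 + n))
    (M B : set X) bd (G : 'rV[R]_(1 + n) -> 'rV[R]_n) J i d0 :
  is_chart bd Q -> (forall g : grp Q, g = 1%g) -> M (phi Q 0) ->
  strict_diff G 0 J -> row_mx (delta_mx i ord0 : 'cV_(1 + n)) J \in unitmx ->
  0 < d0 ->
  (forall v : 'rV_(1 + n), `|v| < d0 -> Defs.dom Q v -> M (phi Q v) <-> G v = 0) ->
  (forall v : 'rV_(1 + n), `|v| < d0 ->
    Defs.dom Q v <-> (B (phi Q 0) -> 0 <= v ord0 i)) ->
  (forall v : 'rV_(1 + n), `|v| < d0 -> Defs.dom Q v -> B (phi Q v) -> v ord0 i = 0) ->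
  exists (r : R) (gam : R -> X), is_arc M B (fun=> r) (fun=> gam) (phi Q 0).
Proof.
move=> hQ g1 M0 sG uJ d0_gt0 HM HD HB; have D0 := Defs.dom0 hQ.
have G0 : G 0 = 0 by apply/HM => //; rewrite normr0.
have [rho [r [kap [/andP[rho0 rhod] r0 kap0 Hk Hu]]]] := implicit_curve sG G0 uJ d0_gt0.
exists r, (fun s => phi Q (kap s)).
have adP s : arc_dom B (fun=> r) (phi Q 0) s <-> `|s| < r /\ (B (phi Q 0) -> 0 <= s).
  rewrite /arc_dom ltr_norml; case: asboolP => Bp; split => [/andP[s1 s2]|[/andP[s1 s2] h]].
  - by split => //; rewrite s2 andbT; lra.
  - by rewrite s2 h.
  - by rewrite s1 s2.
  - by rewrite s1 s2.
have ad s : arc_dom B (fun=> r) (phi Q 0) s ->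
    [/\ `|s| < r, `|kap s| < d0, Defs.dom Q (kap s), kap s ord0 i = s & G (kap s) = 0].
  move=> /adP[sr sB]; have [k1 k2 k3 _] := Hk s sr.
  have kd : `|kap s| < d0 by exact: lt_le_trans k1 rhod.
  by split => //; apply/HD => //; rewrite k2.
split => //.
- by rewrite kap0.
- move=> s t /ad[_ _ Ds ks _] /ad[_ _ Dt kt _] /(chart_phi_inj hQ g1 Ds Dt) E.
  by rewrite -ks E kt.
- split=> s /ad[_ kd Ds ks Gs]; first exact/HM.
  by move=> /(HB _ kd Ds); rewrite ks.
move=> s ds A; have [sr kd Ds ks Gs] := ad s ds; have [k1 _ _ kc] := Hk s sr.
(* From M to parameters by continuity of [phi] and [kap]; the converse, treated second, rests on
   openness of [phi] and uniqueness of the curve. *)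
split=> H; last first.
  have [V [oV Vs VE]] : exists V, [/\ open V, V (phi Q (kap s)) &
      V `<=` [set q | M q -> A q]].
    by move: H; rewrite /prop_near1 nbhsE => -[V [oV Vs] VE]; exists V.
  have [U oU EU] := chart_phi_continuous hQ oV.
  have Uks : U (kap s).
    by have : (Defs.dom Q `&` phi Q @^-1` V) (kap s) by []; rewrite EU => -[].
  have : \forall t \near s, U (kap t) by apply: (kc U); exact: (open_near oU Uks).
  apply: filterS => t Ut dt; have [_ kdt Dt _ Gt] := ad t dt.
  have : (Defs.dom Q `&` U) (kap t) by [].
  by rewrite -EU => -[_ /VE]; apply; apply/HM.
have /nbhs_ballP[e /= e0 He] := H.
(* Here zeros of G lie on the curve, with a parameter in range and close to s; the image of this
   part of the domain is open. *)
pose U := [set v : 'rV[R]_(1 + n) | `|v| < rho] `&`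
  ([set v | `|v ord0 i| < r] `&` [set v | `|v ord0 i - s| < e]).
have cc : continuous (fun v : 'rV[R]_(1 + n) => v ord0 i) by exact: coord_continuous.
have oU : open U.
  apply: openI.
    apply: (@open_comp _ _ (fun v : 'rV[R]_(1 + n) => `|v|) [set x | x < rho]); last exact: open_lt.
    by move=> v _; exact: norm_continuous.
  apply: openI.
    apply: (@open_comp _ _ (fun v : 'rV[R]_(1 + n) => v ord0 i) [set x | `|x| < r]).
      by move=> v _; exact: cc.
    apply: (@open_comp _ _ (fun x : R => `|x|) [set x | x < r]); last exact: open_lt.
    by move=> v _; exact: norm_continuous.
  apply: (@open_comp _ _ (fun v : 'rV[R]_(1 + n) => v ord0 i) [set x | `|x - s| < e]).
    by move=> v _; exact: cc.
  rewrite (_ : [set x | _] = ball s e); first exact: ball_open.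
  by apply/seteqP; split => x; rewrite /ball /= distrC.
have oS : relopen (Defs.dom Q) (Defs.dom Q `&` U) by exists U.
have := open_near (chart_phi_image_open hQ g1 oS).
move=> /(_ (phi Q (kap s))) N.
have {}N : \forall q \near phi Q (kap s), (phi Q @` (Defs.dom Q `&` U)) q.
  apply: N; exists (kap s) => //; split => //; split => //=.
  by rewrite ks subrr normr0.
apply: filterS N => q [v [Dv [vr [ir is']]] <-] Mq.
have vd : `|v| < d0 by exact: lt_le_trans vr rhod.
have Gv : G v = 0 by apply/HM.
rewrite -(Hu v vr ir Gv); apply: He; first by rewrite /ball /= distrC.
by apply/adP; split => //; exact/HD.
Qed.

(** * Charts of the time interval, and the Hausdorff property of the cylinder *)

Section UnitInterval.
Context {R : realType}.
Implicit Types (t : unit_interval R) (s : R).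

Definition endpoint t := (set_val t == 0) || (set_val t == 1).

Lemma unit_interval_bounds t : 0 <= set_val t <= 1.
Proof. by have := set_valP t; rewrite /= in_itv. Qed.

Lemma time_val t s : slice t s ->
  set_val (time t s) = if set_val t == 1 then 1 - s else set_val t + s.
Proof.
move=> ts; rewrite /time; apply: insubdK; rewrite inE /= in_itv /=.
move: ts (unit_interval_bounds t); rewrite /slice.
have [->|t1] := eqVneq (set_val t) 1; first by rewrite orbT /= in_itv /=; lra.
by rewrite orbF; have [->|t0] := eqVneq (set_val t) 0; rewrite /= in_itv /=; lra.
Qed.

Lemma endpoint_time t s : slice t s -> endpoint (time t s) -> endpoint t /\ s = 0.
Proof.
move=> ts; rewrite /endpoint time_val //; move: ts (unit_interval_bounds t); rewrite /slice.
have [->|t1] := eqVneq (set_val t) 1.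
  by rewrite orbT /= in_itv /= => ? ? /orP[/eqP ?|/eqP ?]; split => //; lra.
rewrite orbF; have [->|t0] := eqVneq (set_val t) 0; rewrite /= in_itv /=.
  by move=> ? ? /orP[/eqP ?|/eqP ?]; split => //; lra.
by move=> ? ? /orP[/eqP ?|/eqP ?]; lra.
Qed.

Lemma slice0 t : slice t 0.
Proof.
have := unit_interval_bounds t; rewrite /slice; case: ifP => [_ _|/negbT].
  by rewrite /= in_itv /=; lra.
by rewrite negb_or => /andP[/eqP ? /eqP ?] ?; rewrite /= in_itv /=; lra.
Qed.

Lemma time_at0 t : time t 0 = t.
Proof.
apply: val_inj; rewrite -[LHS]/(set_val _) time_val; last exact: slice0.
by case: eqP => [E|_]; [rewrite subr0; exact: esym | rewrite addr0].
Qed.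

Lemma slice_near t : exists2 e, 0 < e &
  forall s, `|s| < e -> slice t s <-> (endpoint t -> 0 <= s).
Proof.
rewrite /slice /endpoint; case: ifP => [_|/negbT tn].
  exists 1 => // s; rewrite ltr_norml /= in_itv /= => s1; split=> [? _|/(_ isT)]; lra.
exists (Num.min (set_val t) (1 - set_val t)).
  move: tn (unit_interval_bounds t); rewrite negb_or lt_min => /andP[/eqP ? /eqP ?] ?; lra.
move=> s; rewrite lt_min !ltr_norml /= in_itv /= => s1; split=> // _; lra.
Qed.

Lemma endpointP t : endpoint t -> t = time0 R \/ t = time1 R.
Proof. by case/orP => /eqP E; [left | right]; apply: val_inj. Qed.

Lemma cluster_continuous (T U : topologicalType) (f : T -> U) p q :
  continuous f -> hausdorff_space U -> cluster (nbhs p) q -> f p = f q.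
Proof.
move=> cf hU cl; apply: hU => A B nA nB.
have [z [Az Bz]] := cl _ _ (cf p _ nA) (cf q _ nB).
by exists (f z).
Qed.

Lemma cylinder_hausdorff n (O : orbifold R n) : hausdorff_space (cylinder O).
Proof.
move=> [x t] [x' t'] cl; congr pair.
  apply: (cluster_continuous (f := fst) _ (orb_hausdorff (orbifoldP O)) cl).
  by move=> z; exact: cvg_fst.
apply: val_inj.
apply: (cluster_continuous (f := (fun z : cylinder O => set_val z.2 : R)) _ (@Rhausdorff R) cl).
move=> z; apply: continuous_comp; first exact: cvg_snd.
exact: initial_continuous.
Qed.

End UnitInterval.

(** * Local structure of the fibre of F over y *)

Section Fibre.
Context {R : realType} {n : nat} (O P : orbifold R n)
  (F : orb_map (cylinder O) P) (y : P).
Context (F_smooth : smooth_map F) (y_smooth : smooth_point P y)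
  (y_reg : regular_value F y) (codim1_empty : stratum O (n%:Z - 1) = set0).

Lemma chart_at_is_chart (Q : orbifold R n) (x : Q) : is_chart false (chart_at x).
Proof.
have [_ _ [hA _] hc] := orbifoldP Q.
by apply: (atlas_chart hA); case: (hc x).
Qed.

Lemma isotropy_trivial (Q : orbifold R n) (x : Q) : sdim x = n ->
  forall g : isotropy x, g = 1%g.
Proof. exact: chart_isotropy_trivial (chart_at_is_chart x). Qed.

Lemma smooth_isotropy_trivial (g : isotropy y) : g = 1%g.
Proof. by apply: isotropy_trivial; case: y_smooth. Qed.

(** G is the smooth extension supplied by regularity; it is strictly differentiable at 0 even when
    the chart domain lies on one side of 0. The radius [d0] keeps v where G extends the lift and
    where the lift is known to be one. *)
Lemma fibre_local p : F p = y -> exists d0 (G : 'rV[R]_(1 + n) -> 'rV[R]_n),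
  [/\ 0 < d0, is_chart true (chart_at p), strict_diff G 0 (jacobian G 0),
      \rank (jacobian G 0) = n &
      forall v : 'rV_(1 + n), `|v| < d0 -> Defs.dom (chart_at p) v ->
        [/\ Defs.lift F p v = G v, F (phi (chart_at p) v) = y <-> G v = 0 &
          forall g : isotropy p, Defs.lift F p (Defs.act g v) = Defs.lift F p v]].
Proof.
move=> Fp; have [_ _ /(_ p)[W [WD [B [hB sB] BW]] [_ ldom lphi leq]]] := F_smooth.
have hc := chart_at_is_chart (F p).
have [_ _ [hA _] hO] := orbifoldP O.
have hQ : is_chart true (chart_at p).
  by apply: (atlas_chart hB); apply: sB; exists (chart_at p.1); [case: (hO p.1) | exists p.2].
have hW := atlas_chart hB BW.
have [U1 oU1 EW] := chart_restrict_relopen hQ hW WD.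
have U10 : U1 0 by have := Defs.dom0 hW; rewrite /= EW => -[].
have [G [U0 [oU0 U00 sG EG]] surjG] := y_reg Fp.
have [d0 d0_gt0 Hd] : exists2 d, 0 < d & forall v : 'rV[R]_(1 + n), `|v - 0| < d -> (U0 `&` U1) v.
  by apply/near_rvP; apply: open_near => //; exact: openI.
exists d0, G; split => //.
- exact: C1_strict_diff oU0 U00 (sG 1%N).
- apply/eqP; rewrite -/(row_full _) -sub1mx; apply/row_subP => i.
  have [v _ Ev] := surjG (row i 1%:M) I.
  apply/submxP; exists v; rewrite -Ev.
  by rewrite /jacobian mul_rV_lin1.
move=> v vd Dv; have [U0v U1v] : (U0 `&` U1) v by apply: Hd; rewrite subr0.
have Wv : W v by rewrite EW.
have LG : Defs.lift F p v = G v by apply: EG; rewrite inE.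
split => //.
  (* The target group fixes 0, so 0 is alone in its orbit and is the only point of the chart above
     [F p]. *)
  have c0 : phi (chart_at (F p)) 0 = F p by case: (orb_chart_at (orbifoldP P) (F p)).
  have fib := phi_fibre hc (Defs.dom0 hc) (ldom v Wv).
  rewrite -lphi // -LG -Fp -[X in _ = X <-> _]c0.
  split=> [/esym/fib[g ->]|E]; first exact: (act_fix0 hc).
  by apply/esym/fib; exists 1%g; rewrite (act_fix0 hc).
(* As [F p] is the smooth point y, equivariance of the lift becomes invariance. *)
move=> g; rewrite leq //.
have -> : Defs.hom F g = 1%g.
  have : forall h : isotropy (F p), h = 1%g by rewrite Fp; exact: smooth_isotropy_trivial.
  exact.
by rewrite (Defs.act1 hc) //; exact: ldom.
Qed.

Lemma row_mx_0l (w : 'rV[R]_n) : row_mx (0 : 'rV[R]_1) w = w *m row_mx 0 1%:M.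
Proof. by rewrite mul_mx_row mulmx0 mulmx1. Qed.

Lemma norm_row_mx_0l (w : 'rV[R]_n) : `|row_mx (0 : 'rV[R]_1) w| <= `|w|.
Proof.
apply: rv_norm_le => // j; rewrite mxE; case: (fintype.split j) => k.
  by rewrite mxE normr0.
exact: rv_norm_ge.
Qed.

Lemma dom_row_mx_0l (p : cylinder O) (w : 'rV[R]_n) :
  Defs.dom (chart_at p.1) w -> Defs.dom (chart_at p) (row_mx (0 : 'rV[R]_1) w).
Proof.
by move=> Dw; split; rewrite ?row_mxKl ?row_mxKr // mxE; exact: slice0.
Qed.

Lemma strict_diff_slice (G : 'rV[R]_(1 + n) -> 'rV[R]_n) (J : 'M[R]_(1 + n, n)) :
  strict_diff G 0 J ->
  strict_diff (fun w => G (row_mx (0 : 'rV[R]_1) w)) 0 (dsubmx J).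
Proof.
move=> sG; have := strict_diff_linear (row_mx 0 1%:M : 'M[R]_(n, 1 + n)) 0.
move=> /strict_diff_comp; move=> /(_ _ G J); rewrite mul0mx => /(_ sG).
have -> : row_mx 0 1%:M *m J = dsubmx J.
  by rewrite -{1}[J]vsubmxK mul_row_col mul0mx add0r mul1mx.
move=> H e e0; have [d d_gt0 Hd] := H e e0; exists d => // v w vd wd.
by rewrite !row_mx_0l; exact: Hd.
Qed.

Lemma fibre_isotropy p : F p = y -> forall g : isotropy p.1, g = 1%g.
Proof.
move=> Fp; apply: isotropy_trivial.
have [d0 [G [d0_gt0 hQ]]] := fibre_local Fp.
move: (jacobian G 0) => JG sG rG HG.
have hc := chart_at_is_chart p.1.
have oD : open (Defs.dom (chart_at p.1)) by case: (dom_open hc) => // -[].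
have D0 := Defs.dom0 hc.
have : (\rank (dsubmx JG) <= sdim p.1)%N.
  (* The group acts on the second factor only and preserves the slice of time coordinate 0, where G
     coincides with the invariant lift. *)
  apply: (chart_rank_invariants hc (strict_diff_slice sG)) => g.
  have n1 : \forall w \near (0 : 'rV[R]_n), `|w| < d0.
    by apply/near_rvP; exists d0 => // w; rewrite subr0.
  have n2 : \forall w \near (0 : 'rV[R]_n), `|Defs.act g w| < d0.
    have sg := smooth_on_strict_diff oD D0 (act_smooth hc g).
    have nd : \forall v \near (Defs.act g 0), `|v| < d0.
      by rewrite (act_fix0 hc).
    exact: strict_diff_continuous sg _ nd.
  apply: filterS3 n1 n2 (open_near oD D0) => w w1 w2 Dw.
  have Dv := dom_row_mx_0l Dw.
  have Dgv := dom_row_mx_0l (Defs.act_dom hc g Dw).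
  have [E1 _ inv] := HG _ (le_lt_trans (norm_row_mx_0l w) w1) Dv.
  have [E2 _ _] := HG _ (le_lt_trans (norm_row_mx_0l _) w2) Dgv.
  rewrite -E1 -E2 -(inv g); congr (Defs.lift F p _).
  by rewrite /= row_mxKl row_mxKr.
(* The differential is the time row stacked on the slice differential; removing one row lowers the
   rank by at most 1. *)
have : (n <= 1 + \rank (dsubmx JG))%N.
  rewrite -{1}rG -{1}[JG]vsubmxK -addsmxE.
  apply: leq_trans (mxrank_adds_leqif _ _).1 _.
  by rewrite leq_add2r rank_leq_row.
move=> h1 h2; have h3 : (sdim p.1 <= n)%N by exact: rank_leq_row.
have : ~ stratum O (n%:Z - 1) p.1 by rewrite codim1_empty.
move=> h4; apply/eqP; rewrite eqn_leq h3 leqNgt; apply/negP => h5; apply: h4.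
have key (a b : nat) : (a < b)%N -> (b <= 1 + a)%N -> a%:Z = b%:Z - 1.
  move=> ab ba; have -> : b = a.+1 by apply/eqP; rewrite eqn_leq ab andbT.
  by rewrite -addn1 PoszD addrK.
by apply: key h5 _; exact: leq_trans h1 (leq_add (leqnn 1) h2).
Qed.

(** At an end the parameter has to be the time coordinate, so the slice differential must be
    invertible; [Hend] says so in terms of the lift. At other times the chart domain contains a
    ball, and [row_complement] picks a coordinate. *)
Lemma fibre_arc p : F p = y ->
  (endpoint p.2 -> exists J : 'M[R]_n, J \in unitmx /\
    strict_diff (fun w => Defs.lift F p (row_mx (0 : 'rV[R]_1) w)) 0 J) ->
  exists (r : R) (gam : R -> cylinder O),
    is_arc (F @^-1` [set y]) [set q | F q = y /\ endpoint q.2]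
      (fun=> r) (fun=> gam) p.
Proof.
move=> Fp Hend; have [d0 [G [d0_gt0 hQ]]] := fibre_local Fp.
move: (jacobian G 0) => JG sG rG HG.
have hc := chart_at_is_chart p.1.
have oD : open (Defs.dom (chart_at p.1)) by case: (dom_open hc) => // -[].
have /near_rvP[d1 d1_gt0 Hd1] := open_near oD (Defs.dom0 hc).
have [e e0 He] := slice_near p.2.
have p0 : phi (chart_at p) 0 = p.
  have [_ E] := orb_chart_at (orbifoldP O) p.1.
  rewrite /= raddf0 E raddf0 mxE time_at0.
  by case: (p).
set d := Num.min d0 (Num.min d1 e).
have d_gt0 : 0 < d by rewrite !lt_min d0_gt0 d1_gt0.
have dP (v : 'rV[R]_(1 + n)) : `|v| < d ->
    `|v| < d0 /\ (Defs.dom (chart_at p) v <-> (endpoint p.2 -> 0 <= v ord0 (lshift n ord0))).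
  rewrite !lt_min => /and3P[v0 v1 v2]; split => //.
  have Dr : Defs.dom (chart_at p.1) (rsubmx v).
    apply: Hd1; rewrite subr0; apply: le_lt_trans v1; apply: rv_norm_le => // j.
    by rewrite mxE; exact: rv_norm_ge.
  have ve : `|v ord0 (lshift n ord0)| < e by apply: le_lt_trans v2; exact: rv_norm_ge.
  rewrite -(He _ ve) /= mxE; split=> [[]|] //.
have HB (v : 'rV[R]_(1 + n)) : Defs.dom (chart_at p) v ->
    endpoint (phi (chart_at p) v).2 -> endpoint p.2 /\ v ord0 (lshift n ord0) = 0.
  by move=> [Dv _]; rewrite /= mxE in Dv *; exact: endpoint_time.
have g1 : forall g : isotropy p, g = 1%g by exact: fibre_isotropy.
rewrite -{1}p0.
have [ep|nep] := boolP (endpoint p.2).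
  have [J [uJ sJ]] := Hend ep.
  (* The lift and G agree near 0 on the slice, so their slice derivatives are equal. *)
  have D : dsubmx JG = J.
    apply: strict_diff_unique (strict_diff_slice sG) sJ _ => c c0.
    exists 0; first by rewrite subrr normr0.
    have n1 : \forall w \near (0 : 'rV[R]_n), `|w| < d0.
      by apply/near_rvP; exists d0 => // w; rewrite subr0.
    apply: filterS2 n1 (open_near oD (Defs.dom0 hc)) => w w1 Dw.
    by have [E1 _ _] := HG _ (le_lt_trans (norm_row_mx_0l w) w1) (dom_row_mx_0l Dw).
  apply: (chart_arc hQ g1 _ sG (row_complement0 _) d_gt0) => //.
  - by move: Fp; rewrite -{1}p0.
  - by rewrite D.
  - by move=> v /dP[v0 _] Dv; have [] := HG v v0 Dv.
  - by move=> v /dP[_ ->]; rewrite p0; split=> h *; apply: h; rewrite //= Fp.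
  - by move=> v _ Dv [_ /(HB v Dv)[]].
have [i ui] := row_complement rG.
apply: (chart_arc hQ g1 _ sG ui d_gt0) => //.
- by move: Fp; rewrite -{1}p0.
- by move=> v /dP[v0 _] Dv; have [] := HG v v0 Dv.
- by move=> v /dP[_ ->]; rewrite p0; split=> [_ [_]|_] ep; move: nep; rewrite ep.
- by move=> v _ Dv [_ /(HB v Dv)[ep]]; move: nep; rewrite ep.
Qed.

End Fibre.

(** * The fibres of f and g as the two ends, and their degrees *)

Lemma end_slice_regular (R : realType) n (O P : orbifold R n) (f : orb_map O P)
    (F : orb_map (cylinder O) P) (t : unit_interval R) y x :
  map_eq (orb_comp F (time_incl O t)) f -> regular_value f y -> F (x, t) = y ->
  exists J : 'M[R]_n, J \in unitmx /\
    strict_diff (fun w => Defs.lift F (x, t) (row_mx (0 : 'rV[R]_1) w)) 0 J.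
Proof.
move=> /(_ x)[e [[W [WD aW] EW] _]] reg Fxt.
have hc := chart_at_is_chart x.
have oD : open (Defs.dom (chart_at x)) by case: (dom_open hc) => // -[].
have hW : is_chart false (Defs.restrict (chart_at x) W).
  by have [_ _ [hA _] _] := orbifoldP O; exact: atlas_chart aW.
have oW : open W by case: (dom_open hW) => // -[].
have fx : f x = y by rewrite -e.
have [g [U [oU U0 sg Eg]] surjg] := reg _ fx.
exists (jacobian g 0); split.
  rewrite -row_full_unit -sub1mx; apply/row_subP => i.
  have [v _ Ev] := surjg (row i 1%:M) I.
  by apply/submxP; exists v; rewrite -Ev /jacobian mul_rV_lin1.
(* By [map_eq] the slice of the lift of F is the lift of f near 0, and g extends the latter. *)
apply: strict_diff_near (C1_strict_diff oU U0 (sg 1%N)).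
apply: filterS3 (open_near oU U0) (open_near oW (Defs.dom0 hW))
  (open_near oD (Defs.dom0 hc)) => w Uw Ww Dw.
rewrite -Eg ?inE //; apply/esym; apply: EW; by rewrite inE.
Qed.

Lemma card_trivial_group (gT : finGroupType) : (forall g : gT, g = 1%g) -> #|gT| = 1%N.
Proof. by move=> g1; apply/eqP/fintype1P; exists 1%g. Qed.

Lemma deg2_size (R : realType) n (O P : orbifold R n) (f : orb_map O P) y (L : seq O) :
  (forall g : isotropy y, g = 1%g) ->
  (forall x, f x = y -> forall g : isotropy x, g = 1%g) ->
  uniq L -> (forall x, x \in L <-> f x = y) -> deg2 f y = (size L %% 2)%N.
Proof.
move=> hy hx uL LP; rewrite /deg2; congr (_ %% 2)%N.
rewrite /weighted_card (_ : _ @^-1` _ = [set` L]); last first.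
  by apply/seteqP; split => x /LP.
rewrite -fsbig_seq // (eq_big_seq (fun=> 1)) => [|x /LP fx].
  by rewrite big_const_seq count_predT iter_addr_0 natrK.
by rewrite !card_trivial_group ?divr1 //; exact: hx.
Qed.

Theorem lemma3p6 (R : realType) (n : nat) (O P : orbifold R n)
    (f g : orb_map O P) (F : orb_map (cylinder O) P)
    (f_smooth : smooth_map f) (f_proper : proper_map f)
    (g_smooth : smooth_map g) (g_proper : proper_map g)
    (F_homotopy : homotopy F f g) (F_proper : proper_map F)
    (y : P)
    (y_smooth : smooth_point P y)
    (y_regF : regular_value F y)
    (y_regf : regular_value f y) (y_regg : regular_value g y)
    (codim1_empty : stratum O (n%:Z - 1) = set0) :
  deg2 f y = deg2 g y.
Proof.
have [F_smooth F0 F1] := F_homotopy.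
have e0 x : F (x, time0 R) = f x by have [] := F0 x.
have e1 x : F (x, time1 R) = g x by have [] := F1 x.
pose M := F @^-1` [set y].
pose B := [set q : cylinder O | F q = y /\ endpoint q.2].
(* Radius and parametrisation are paired so that a single choice yields both; the pair given off M
   is arbitrary. *)
have arc p : exists rg : R * (R -> cylinder O), M p ->
    is_arc M B (fun=> rg.1) (fun=> rg.2) p.
  have [Mp|nMp] := pselect (M p); last by exists (0, fun=> p).
  have [|r [gam H]] := fibre_arc F_smooth y_smooth y_regF codim1_empty Mp.
    case: p Mp => x t Mp /= /endpointP[] E; subst t.
      exact: end_slice_regular F0 y_regf Mp.
    exact: end_slice_regular F1 y_regg Mp.
  by exists (r, gam).
have [rg Hrg] := choice arc.
have cM : compact M by apply: F_proper; exact: compact_set1.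
have BM : B `<=` M by move=> q [].
have [L [uL LP oL]] := even_boundary Hrg (@cylinder_hausdorff _ _ O) cM BM.
pose at0 (q : cylinder O) := set_val q.2 == 0 :> R.
have n01 : (1 == 0 :> R) = false by rewrite oner_eq0.
have hx x t : F (x, t) = y -> forall h : isotropy x, h = 1%g.
  exact: (fibre_isotropy F_smooth y_smooth y_regF codim1_empty (p := (x, t))).
pose L0 := [seq q.1 | q <- L & at0 q]; pose L1 := [seq q.1 | q <- L & ~~ at0 q].
have B0 q : q \in [seq q <- L | at0 q] -> q = (q.1, time0 R).
  rewrite mem_filter => /andP[/eqP q0 _]; case: q q0 => x t /= t0.
  by congr pair; apply: val_inj.
(* Members of L lie over an end, so those not at time 0 are at time 1; the projection to O is
   therefore injective on each half of L. *)
have B1 q : q \in [seq q <- L | ~~ at0 q] -> q = (q.1, time1 R).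
  rewrite mem_filter => /andP[q0 /LP[_ /orP[]]]; first by move: q0; rewrite /at0 => /negbTE ->.
  case: q q0 => x t _ /= /eqP t1; by congr pair; apply: val_inj.
have u0 : uniq L0.
  rewrite map_inj_in_uniq ?filter_uniq // => p q /B0 -> /B0 -> /= ->.
  by [].
have u1 : uniq L1.
  rewrite map_inj_in_uniq ?filter_uniq // => p q /B1 -> /B1 -> /= ->.
  by [].
have P0 x : x \in L0 <-> f x = y.
  split=> [/mapP[q qL ->]|fx].
    by move: qL (B0 q qL); rewrite mem_filter => /andP[_ /LP[Fq _]] E; rewrite -e0 -E.
  apply/mapP; exists (x, time0 R) => //; rewrite mem_filter /at0 eqxx /=.
  by apply/LP; split; rewrite ?e0 //= /endpoint eqxx.
have P1 x : x \in L1 <-> g x = y.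
  split=> [/mapP[q qL ->]|gx].
    by move: qL (B1 q qL); rewrite mem_filter => /andP[_ /LP[Fq _]] E; rewrite -e1 -E.
  apply/mapP; exists (x, time1 R) => //; rewrite mem_filter /at0 n01 /=.
  by apply/LP; split; rewrite ?e1 //= /endpoint eqxx orbT.
have hy := smooth_isotropy_trivial y_smooth.
rewrite (deg2_size hy _ u0 P0); last by move=> x fx; apply: (hx x (time0 R)); rewrite e0.
rewrite (deg2_size hy _ u1 P1); last by move=> x gx; apply: (hx x (time1 R)); rewrite e1.
move: oL; rewrite !modn2 !size_map !size_filter -(count_predC at0) oddD.
by rewrite negb_add => /eqP ->.
Qed.
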